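(* Let $F$ be a Finsler function on a connected smooth manifold $M$ of dimension $n\ge 3$, let $S$ be its geodesic spray, with Jacobi endomorphism $\Phi$ and curvature tensor $R$, and let $$W_1=R-\frac{1}{2(n-1)}\,d_J(\operatorname{Tr}\Phi)\wedge J .$$ Then $F$ has constant flag curvature if and only if $W_1=0$.
   Context: $M$ is a connected smooth $n$-manifold, $TM$ its tangent bundle with induced coordinates $(x^i,y^i)$, $T_0M$ the tangent bundle with the zero section removed. $\mathcal C=y^i\frac{\partial}{\partial y^i}$ is the Liouville vector field and $J=dx^i\otimes\frac{\partial}{\partial y^i}$ the tangent endomorphism. A Finsler function is a continuous $F:TM\to\mathbb R$, smooth and strictly positive on $T_0M$, with $F(x,\lambda y)=\lambda F(x,y)$ for $\lambda>0$, and such that $g_{ij}=\frac12\frac{\partial^2F^2}{\partial y^i\partial y^j}$ has rank $n$ on $T_0M$. Its geodesic spray is the unique vector field $S=y^i\frac{\partial}{\partial x^i}-2G^i(x,y)\frac{\partial}{\partial y^i}$ on $T_0M$ with $i_S\,dd_JF^2=-dF^2$. For a spray $S$ put $N^i_j=\partial G^i/\partial y^j$ and $\frac{\delta}{\delta x^i}=\frac{\partial}{\partial x^i}-N^j_i\frac{\partial}{\partial y^j}$; the horizontal projector is $h=\frac{\delta}{\delta x^i}\otimes dx^i$. The Jacobi endomorphism is $\Phi=R^i_j\,\frac{\partial}{\partial y^i}\otimes dx^j$ with $R^i_j=2\frac{\delta G^i}{\delta x^j}-S(N^i_j)+N^i_kN^k_j$, and $\operatorname{Tr}\Phi=R^i_i$.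 The curvature tensor of the nonlinear connection is $R=\frac12[h,h]$ (Frölicher–Nijenhuis bracket), i.e. $R=\frac12R^k_{ij}\,dx^i\wedge dx^j\otimes\frac{\partial}{\partial y^k}$ with $R^k_{ij}=\frac{\delta N^k_i}{\delta x^j}-\frac{\delta N^k_j}{\delta x^i}$; it satisfies $i_SR=\Phi$ and $3R=[J,\Phi]$. For a function $f$ on $T_0M$, $d_Jf=\frac{\partial f}{\partial y^i}dx^i$. For a semi-basic 1-form $\beta=\beta_i\,dx^i$, $\beta\wedge J=\beta_i\,dx^i\wedge dx^j\otimes\frac{\partial}{\partial y^j}$. $F$ has constant flag curvature if there is a constant $\kappa$ with $\Phi=\kappa F^2J-\kappa F\,d_JF\otimes\mathcal C$. *)

(* Defs.v *)
From mathcomp Require Import all_boot all_order all_algebra.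
From mathcomp Require Import all_classical all_reals all_analysis.

Set Implicit Arguments.
Unset Strict Implicit.
Unset Printing Implicit Defensive.

Import Order.TTheory GRing.Theory Num.Theory.
Import numFieldNormedType.Exports.

Local Open Scope classical_set_scope.
Local Open Scope ring_scope.

(* Meant for [U] open and [V] finite dimensional, where it is the usual notion:
   all iterated directional derivatives exist and are continuous on [U]. *)
Fixpoint Ck_on (R : realType) (V W : normedModType R) (k : nat) (U : set V)
    (f : V -> W) : Prop :=
  match k with
  | 0 => forall x, U x -> {for x, continuous f}
  | k'.+1 => (forall x, U x -> differentiable f x) /\
             (forall v : V, Ck_on k' U ('D_v f))
  end.

Definition smooth_on (R : realType) (V W : normedModType R) (U : set V)
    (f : V -> W) : Prop := forall k, Ck_on k U f.

Lemma diff_near_comp (R : realType) (U V W : normedModType R)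
    (f : U -> V) (g : V -> W) (h : U -> W) (x y : U) :
  differentiable f x -> differentiable g (f x) -> differentiable h x ->
  (\near x, h x = g (f x)) -> 'd h x y = 'd g (f x) ('d f x y).
Proof.
move=> df dg dh hgf; have dgf := differentiable_comp df dg.
have := congr1 (fun k : U -> W => k y) (diff_comp df dg); rewrite /= => <-.
have hE := deriveE y dh.
have gE := deriveE y dgf.
apply: (etrans (esym hE)).
apply: (etrans _ gE).
exact: near_eq_derive.
Qed.

(* A smooth structure is given by any smooth atlas, not necessarily maximal.
   [chart a] and [chart_inv a] are total functions, of which only the
   restrictions to [chart_dom a] and [chart_im a] are meaningful. *)
Record smoothManifold (R : realType) (n : nat) := SmoothManifold {
  carrier :> topologicalType;
  carrier_hausdorff : hausdorff_space carrier;
  carrier_second_countable : @second_countable carrier;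
  index : Type;
  chart_dom : index -> set carrier;
  chart_im : index -> set 'rV[R]_n;
  chart : index -> carrier -> 'rV[R]_n;
  chart_inv : index -> 'rV[R]_n -> carrier;
  chart_dom_open : forall a, open (chart_dom a);
  chart_im_open : forall a, open (chart_im a);
  chart_cover : forall p, exists a, chart_dom a p;
  chart_sub : forall a p, chart_dom a p -> chart_im a (chart a p);
  chart_inv_sub : forall a x, chart_im a x -> chart_dom a (chart_inv a x);
  chartK : forall a p, chart_dom a p -> chart_inv a (chart a p) = p;
  chart_invK : forall a x, chart_im a x -> chart a (chart_inv a x) = x;
  chart_continuous :
    forall a p, chart_dom a p -> {for p, continuous (chart a)};
  chart_inv_continuous :
    forall a x, chart_im a x -> {for x, continuous (chart_inv a)};
  trans_smooth : forall a b,
    smooth_on [set x | chart_im a x /\ chart_dom b (chart_inv a x)]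
              (chart b \o chart_inv a)
}.

Section TangentBundle.
Variables (R : realType) (n : nat) (M : smoothManifold R n).
Local Notation V := 'rV[R]_n.

Definition trans (a b : index M) : V -> V := chart b \o chart_inv a.

(* A tangent vector at a point is the family of its component vectors in the
   charts around that point, any two of which are related by the Jacobian of
   the change of coordinates. *)
Record tangentBundle := TangentBundle {
  base : M;
  comp : index M -> V;
  comp_trans : forall a b, chart_dom a base -> chart_dom b base ->
    comp b = 'd (trans a b) (chart a base) (comp a);
  comp_out : forall a, ~ chart_dom a base -> comp a = 0
}.

Definition tangent_comp (a : index M) (p : M) (y : V) (b : index M) : V :=
  if pselect (chart_dom a p /\ chart_dom b p)
  then 'd (trans a b) (chart a p) y else 0.

Lemma trans_differentiable a b p : chart_dom a p -> chart_dom b p ->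
  differentiable (trans a b) (chart a p).
Proof.
move=> pa pb; have [df _] := @trans_smooth _ _ M a b 1%N.
by apply: df; split; [exact: chart_sub|rewrite chartK].
Qed.

Lemma diff_trans a b c p y :
  chart_dom a p -> chart_dom b p -> chart_dom c p ->
  'd (trans a c) (chart a p) y =
  'd (trans b c) (chart b p) ('d (trans a b) (chart a p) y).
Proof.
move=> pa pb pc.
have dab := trans_differentiable pa pb.
have tabE : trans a b (chart a p) = chart b p by rewrite /trans /= chartK.
have dbc : differentiable (trans b c) (trans a b (chart a p)).
  by rewrite tabE; exact: trans_differentiable.
rewrite -tabE; apply: (diff_near_comp y dab dbc (trans_differentiable pa pc)).
have im_pa := chart_sub pa.
have nb : nbhs (chart_inv a (chart a p)) (chart_dom b).
  by rewrite chartK //; apply: open_nbhs_nbhs; split; [exact: chart_dom_open|].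
have : nbhs (chart a p) (chart_inv a @^-1` chart_dom b).
  exact: (@chart_inv_continuous _ _ M a (chart a p) im_pa _ nb).
by apply: filterS => w /= wb; rewrite /trans /= chartK.
Qed.

Lemma tangent_comp_trans a p y b c : chart_dom b p -> chart_dom c p ->
  tangent_comp a p y c =
  'd (trans b c) (chart b p) (tangent_comp a p y b).
Proof.
rewrite /tangent_comp => pb pc.
case: pselect => [[pa pc']|nac]; case: pselect => [[pa' pb']|nab].
- exact: diff_trans.
- by case: nab.
- by case: nac.
- exact: (esym (linear0 ('d (trans b c) (chart b p)))).
Qed.

Lemma tangent_comp_out a p y b : ~ chart_dom b p -> tangent_comp a p y b = 0.
Proof. by rewrite /tangent_comp => npb; case: pselect => // -[]. Qed.

(* Inverse of the chart [v |-> (chart a (base v), comp v a)] of [TM] induced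
   by [chart a]; meaningful for [chart_im a x]. *)
Definition tangent_of (a : index M) (x y : V) : tangentBundle :=
  @TangentBundle (chart_inv a x) (tangent_comp a (chart_inv a x) y)
    (@tangent_comp_trans a (chart_inv a x) y)
    (@tangent_comp_out a (chart_inv a x) y).

Definition T_dom (a : index M) : set (V * V) := [set z | chart_im a z.1].

Definition T0_dom (a : index M) : set (V * V) :=
  [set z | chart_im a z.1 /\ z.2 != 0].

(* [F] in the induced coordinates (x, y) of chart [a]. The topology and smooth
   structure of [TM] are those for which these coordinates are charts. *)
Definition repr (F : tangentBundle -> R) (a : index M) : V * V -> R :=
  fun z => F (tangent_of a z.1 z.2).

Definition T_trans (a b : index M) : V * V -> V * V :=
  fun z => (trans a b z.1, 'd (trans a b) (z.1) z.2).

(* [vf a z] is the pair of the d/dx and d/dy components of the field at [z] in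
   the induced coordinates of chart [a]. *)
Record vectorFieldT0 := VectorFieldT0 {
  vf :> index M -> V * V -> V * V;
  vf_smooth : forall a, smooth_on (T0_dom a) (vf a);
  vf_trans : forall a b z, T0_dom a z -> chart_dom b (chart_inv a z.1) ->
    vf b (T_trans a b z) = 'd (T_trans a b) z (vf a z)
}.

End TangentBundle.

Section LocalCalculus.
Variables (R : realType) (n : nat).
Local Notation V := 'rV[R]_n.

Definition ddx (i : 'I_n) (f : V * V -> R) : V * V -> R :=
  'D_((delta_mx 0 i, 0) : V * V) f.

Definition ddy (i : 'I_n) (f : V * V -> R) : V * V -> R :=
  'D_((0, delta_mx 0 i) : V * V) f.

Definition tangentJ (X : V * V) : V * V := (0, X.1).

(* d_J f = df o J, evaluated at the point [z] on the vector [X] *)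
Definition dJ_form (f : V * V -> R) (z X : V * V) : R := 'd f z (tangentJ X).

(* (d theta)(X, Y) = X (theta Y) - Y (theta X) for constant fields X, Y *)
Definition ext_d (theta : V * V -> V * V -> R) (z X Y : V * V) : R :=
  'D_X (fun w => theta w Y) z - 'D_Y (fun w => theta w X) z.

(* Components beta_i of the semi-basic 1-form d_J f = beta_i dx^i *)
Definition dJ (f : V * V -> R) (i : 'I_n) : V * V -> R := ddy i f.

(* Vector-valued 2-forms (1/2) T^k_ij dx^i /\ dx^j (x) d/dy^k are encoded by
   their components [T k i j], antisymmetric in [i], [j]; those of beta /\ J
   are beta_i delta^k_j - beta_j delta^k_i. *)
Definition wedgeJ (beta : 'I_n -> V * V -> R) (k i j : 'I_n) : V * V -> R :=
  fun z => beta i z * (k == j)%:R - beta j z * (k == i)%:R.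

End LocalCalculus.

Section Finsler.
Variables (R : realType) (n : nat) (M : smoothManifold R n).
Local Notation V := 'rV[R]_n.
Implicit Types (F : tangentBundle M -> R) (S : vectorFieldT0 M).

Definition metric F (a : index M) (z : V * V) : 'M[R]_n :=
  \matrix_(i, j) (2^-1 * ddy i (ddy j (fun w => repr F a w ^+ 2)) z).

Record isFinsler F : Prop := IsFinsler {
  finsler_continuous : forall a z, T_dom a z -> {for z, continuous (repr F a)};
  finsler_smooth : forall a, smooth_on (T0_dom a) (repr F a);
  finsler_gt0 : forall a z, T0_dom a z -> 0 < repr F a z;
  finsler_homogeneous : forall a z (l : R), T_dom a z -> 0 < l ->
    repr F a (z.1, l *: z.2) = l * repr F a z;
  finsler_rank : forall a z, T0_dom a z -> \rank (metric F a z) = n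
}.

(* S = y^i d/dx^i - 2 G^i d/dy^i and i_S dd_J F^2 = - dF^2 on T_0 M *)
Record isGeodesicSpray F S : Prop := IsGeodesicSpray {
  spray_dx : forall a z, T0_dom a z -> (S a z).1 = z.2;
  spray_eq : forall a z, T0_dom a z -> forall Y : V * V,
    ext_d (dJ_form (fun w => repr F a w ^+ 2)) z (S a z) Y =
    - 'd (fun w => repr F a w ^+ 2) z Y
}.

Definition sprayG S a (i : 'I_n) : V * V -> R :=
  fun z => - (2^-1 * (S a z).2 0 i).

Definition sprayN S a (i j : 'I_n) : V * V -> R := ddy j (sprayG S a i).

Definition deltax S a (i : 'I_n) (f : V * V -> R) : V * V -> R :=
  fun z => ddx i f z - \sum_(j < n) sprayN S a j i z * ddy j f z.

(* [Jacobi S a z i j] is R^i_j *)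
Definition Jacobi S a (z : V * V) : 'M[R]_n :=
  \matrix_(i, j) (2 * deltax S a j (sprayG S a i) z
                  - 'D_(S a z) (sprayN S a i j) z
                  + \sum_(k < n) sprayN S a i k z * sprayN S a k j z).

(* Components R^k_ij of (1/2)[h, h] for h = delta/delta x^i (x) dx^i: the bracket
   [delta/delta x^i, delta/delta x^j] is R^k_ij d/dy^k. *)
Definition curvature S a (k i j : 'I_n) : V * V -> R :=
  fun z => deltax S a j (sprayN S a k i) z - deltax S a i (sprayN S a k j) z.

Definition W1 S a (k i j : 'I_n) : V * V -> R :=
  fun z => curvature S a k i j z
    - (2 * (n%:R - 1))^-1 * wedgeJ (dJ (fun w => \tr (Jacobi S a w))) k i j z.

(* Phi = kappa F^2 J - kappa F d_J F (x) C, with C = y^i d/dy^i *)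
Definition constant_flag_curvature F S : Prop :=
  exists kappa : R, forall a z, T0_dom a z -> forall i j : 'I_n,
    Jacobi S a z i j = kappa * repr F a z ^+ 2 * (i == j)%:R
                       - kappa * repr F a z * dJ (repr F a) j z * z.2 0 i.

Definition W1_eq0 S : Prop :=
  forall a z, T0_dom a z -> forall k i j : 'I_n, W1 S a k i j z = 0.

End Finsler.

(* Main.v *)
From HB Require Import structures.
Require Import Defs.
From mathcomp Require Import all_boot all_order all_algebra.
From mathcomp Require Import all_classical all_reals all_analysis.
From mathcomp Require Import ring lra.

(* Write E = F^2 and t = Tr Phi. If Phi is that of constant flag curvature, then
   3 R = [J, Phi] gives W_1 = 0. Conversely W_1 = 0 says that, up to a constant
   factor, R^k_ij = t_i delta^k_j - t_j delta^k_i with t_i = dt/dy^i. Contracting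
   with y^i gives Phi; contracting with dE/dy^k and using that E is horizontally
   constant gives E t_i = t E_i, so that kappa = t / ((n - 1) E) does not depend
   on y. The Bianchi identity for R and n >= 3 give (delta_i t) E_j =
   (delta_j t) E_i; differentiating in y and using that the metric is
   nondegenerate, delta_i t = 0. Hence kappa is locally constant in each chart,
   and it is the same function in all charts because R is a tensor.

   All identities in a chart are identities in the ring of smooth functions on
   an open set, where only commuting derivations are used. *)

Set Implicit Arguments.
Unset Strict Implicit.
Unset Printing Implicit Defensive.

Import Order.TTheory GRing.Theory Num.Theory.
Import numFieldNormedType.Exports.

Local Open Scope classical_set_scope.
Local Open Scope ring_scope.

(** * Algebra of sprays over a ring with commuting derivations *)

(** Rings of smooth functions may have zero divisors, so the quotient t / E is not formed there:
    identities are kept multiplied out, and only positive integers, E and the Hessian of E are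
    cancelled. The relation E t_i = t E_i starts from R^k_ij E_k = 0, the bracket of two horizontal
    fields applied to E. When (delta_i t) E_j = (delta_j t) E_i is differentiated in y, the
    derivatives of delta_i t drop out because E d(delta_i t)/dy^k = (delta_i t) E_k. What is left is
    (delta_i t) g_jk = (delta_j t) g_ik, and for j distinct from i nondegeneracy kills both
    coefficients. Homogeneity of the G^i is not part of the definition of a geodesic spray, so it is
    derived from the equation of the spray. *)

Lemma exists_neq2 n : (3 <= n)%N -> forall i j : 'I_n,
  exists2 l : 'I_n, l != i & l != j.
Proof.
move=> n_ge3 i j; have /card_gt0P [l] : (0 < #|~: [set i; j]|)%N.
  rewrite finset.cardsCs finset.setCK card_ord subn_gt0 (leq_ltn_trans _ n_ge3) //.
  by rewrite cards2; case: eqP.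
by rewrite !inE negb_or => /andP[] ? ?; exists l.
Qed.

Section Derivations.
Variable A : comPzRingType.

(** The ring may be zero, as over an empty overlap of charts; hence [comPzRingType]. *)
Definition derivation (D : A -> A) : Prop :=
  (forall a b, D (a + b) = D a + D b) /\
  (forall a b, D (a * b) = D a * b + a * D b).

Section One.
Variable D : A -> A.
Hypothesis dD : derivation D.

Lemma derivationD a b : D (a + b) = D a + D b. Proof. by case: dD. Qed.
Lemma derivationM a b : D (a * b) = D a * b + a * D b. Proof. by case: dD. Qed.
Lemma derivation0 : D 0 = 0.
Proof. by apply: (addrI (D 0)); rewrite -derivationD !addr0. Qed.
Lemma derivationN a : D (- a) = - D a.
Proof. by apply: (addrI (D a)); rewrite -derivationD !subrr derivation0. Qed.
Lemma derivationB a b : D (a - b) = D a - D b.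
Proof. by rewrite derivationD derivationN. Qed.
Lemma derivation_sum (I : finType) (f : I -> A) : D (\sum_i f i) = \sum_i D (f i).
Proof. exact: (big_morph D derivationD derivation0). Qed.
Lemma derivation1 : D 1 = 0.
Proof.
apply: (addrI (D 1)); rewrite addr0.
by rewrite -{3}(mulr1 1) derivationM mulr1 mul1r.
Qed.
Lemma derivation_nat m : D m%:R = 0.
Proof.
elim: m => [|m IH]; first exact: derivation0.
by rewrite -natr1 derivationD IH derivation1 addr0.
Qed.
Lemma derivationMnl m a : D (m%:R * a) = m%:R * D a.
Proof. by rewrite derivationM derivation_nat mul0r add0r. Qed.

End One.

Lemma derivation_sub (D D' : A -> A) : derivation D -> derivation D' ->
  derivation (fun f => D f - D' f).
Proof.
move=> dD dD'; split=> a b; first by rewrite (derivationD dD) (derivationD dD'); ring.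
by rewrite (derivationM dD) (derivationM dD'); ring.
Qed.

Lemma derivation_comb (I : finType) (c : I -> A) (D : I -> A -> A) :
  (forall i, derivation (D i)) -> derivation (fun f => \sum_i c i * D i f).
Proof.
move=> dD; split=> a b.
  by rewrite -big_split; apply: eq_bigr => i _ /=; rewrite (derivationD (dD i)) mulrDr.
rewrite mulr_suml mulr_sumr -big_split; apply: eq_bigr => i _ /=.
by rewrite (derivationM (dD i)); ring.
Qed.

End Derivations.

(* [P i], [Q i] stand for d/dx^i, d/dy^i and [y i], [G i] for the functions
   y^i, G^i. *)
Section Spray.
Variables (A : comPzRingType) (n : nat) (P Q : 'I_n -> A -> A) (y G : 'I_n -> A).
Hypotheses (dP : forall i, derivation (P i)) (dQ : forall i, derivation (Q i)).
Hypotheses (PP : forall i j f, P i (P j f) = P j (P i f))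
  (QP : forall i j f, Q i (P j f) = P j (Q i f))
  (QQ : forall i j f, Q i (Q j f) = Q j (Q i f)).
Hypotheses (Py : forall i j, P i (y j) = 0)
  (Qy : forall i j, Q i (y j) = (i == j)%:R).

Definition liouville f := \sum_i y i * Q i f.
Definition spray f := \sum_i y i * P i f - \sum_i 2 * G i * Q i f.
Definition nonlin i j := Q j (G i).
Definition hor i f := P i f - \sum_j nonlin j i * Q j f.
Definition curv k i j := hor j (nonlin k i) - hor i (nonlin k j).
Definition jacobi i j :=
  2 * hor j (G i) - spray (nonlin i j) + \sum_k nonlin i k * nonlin k j.

Lemma derivation_liouville : derivation liouville.
Proof. exact: derivation_comb. Qed.

Lemma derivation_spray : derivation spray.
Proof. by apply: derivation_sub; apply: derivation_comb. Qed.

Lemma derivation_hor i : derivation (hor i).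
Proof. by apply: derivation_sub => //; apply: derivation_comb. Qed.

Lemma sum_delta (f : 'I_n -> A) i : \sum_j f j * (i == j)%:R = f i.
Proof.
rewrite (bigD1 i) //= eqxx mulr1 big1 ?addr0 // => j ji.
by rewrite eq_sym (negbTE ji) mulr0.
Qed.

Lemma sum_delta' (f : 'I_n -> A) i : \sum_j f j * (j == i)%:R = f i.
Proof. by rewrite -[RHS]sum_delta; apply: eq_bigr => j _; rewrite eq_sym. Qed.

Let QM i := derivationM (dQ i).
Let PM i := derivationM (dP i).
Let QB i := derivationB (dQ i).
Let Qs i := derivation_sum (dQ i).
Let Ps i := derivation_sum (dP i).
Let hM i := derivationM (derivation_hor i).
Let hB i := derivationB (derivation_hor i).
Let hs i := derivation_sum (derivation_hor i).
Let CM := derivationM derivation_liouville.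
Let CB := derivationB derivation_liouville.
Let Cs := derivation_sum derivation_liouville.
Let SM := derivationM derivation_spray.
Let Ss := derivation_sum derivation_spray.

Lemma nonlinC k i j : Q i (nonlin k j) = Q j (nonlin k i).
Proof. by rewrite /nonlin QQ. Qed.

Lemma liouville_y j : liouville (y j) = y j.
Proof.
rewrite /liouville -[RHS](sum_delta' y); apply: eq_bigr => i _.
by rewrite Qy.
Qed.

Lemma hor_y i j : hor i (y j) = - nonlin j i.
Proof.
rewrite /hor Py sub0r -[X in _ = - X](sum_delta' (nonlin^~ i)); congr (- _).
by apply: eq_bigr => k _; rewrite Qy.
Qed.

Lemma spray_y j : spray (y j) = - (2 * G j).
Proof.
rewrite /spray big1 ?sub0r; last by move=> i _; rewrite Py mulr0.
rewrite -[X in _ = - X](sum_delta' (fun j => 2 * G j)); congr (- _).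
by apply: eq_bigr => k _; rewrite Qy.
Qed.

(** The bracket of delta/delta x^j and d/dy^i is vertical. Its components dN^k_j/dy^i are the
    Berwald coefficients, whose symmetry is [nonlinC]. *)
Lemma Q_hor i j f : Q i (hor j f) = hor j (Q i f) - \sum_k Q i (nonlin k j) * Q k f.
Proof.
rewrite /hor QB Qs QP -addrA -opprD -big_split; congr (_ - _).
by apply: eq_bigr => k _ /=; rewrite QM QQ addrC.
Qed.

(** All terms but the last are symmetric in [i] and [j], alone or paired with a neighbour, so the
    bracket in [hor_comm] retains only the last. *)
Lemma hor_hor i j f : hor i (hor j f) =
  P i (P j f) - \sum_k nonlin k i * P j (Q k f) - \sum_k nonlin k j * P i (Q k f)
  + \sum_k \sum_l nonlin k j * (nonlin l i * Q l (Q k f))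
  - \sum_k hor i (nonlin k j) * Q k f.
Proof.
rewrite {2}/hor hB hs.
under eq_bigr => k _ do rewrite hM {2}/hor mulrBr mulr_sumr.
rewrite big_split sumrB /=.
have -> : hor i (P j f) = P i (P j f) - \sum_k nonlin k i * P j (Q k f).
  by congr (_ - _); apply: eq_bigr => k _; rewrite QP.
ring.
Qed.

Lemma hor_comm i j f : hor i (hor j f) - hor j (hor i f) = \sum_k curv k i j * Q k f.
Proof.
rewrite !hor_hor PP.
rewrite [X in _ - (_ + X - _)]exchange_big /=.
have -> : \sum_k curv k i j * Q k f = \sum_k hor j (nonlin k i) * Q k f -
    \sum_k hor i (nonlin k j) * Q k f.
  by rewrite -sumrB; apply: eq_bigr => k _; rewrite mulrBl.
have -> : \sum_k \sum_l nonlin l i * (nonlin k j * Q k (Q l f)) =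
  \sum_k \sum_l nonlin k j * (nonlin l i * Q l (Q k f)).
  by apply: eq_bigr => k _; apply: eq_bigr => l _; rewrite QQ mulrCA.
ring.
Qed.

Lemma Q_liouville i f : Q i (liouville f) = Q i f + liouville (Q i f).
Proof.
rewrite /liouville Qs -[X in _ = X + _](sum_delta (fun j => Q j f)) -big_split.
by apply: eq_bigr => j _ /=; rewrite QM Qy QQ mulrC.
Qed.

Lemma P_liouville i f : P i (liouville f) = liouville (P i f).
Proof.
by rewrite /liouville Ps; apply: eq_bigr => j _; rewrite PM Py mul0r add0r QP.
Qed.

Lemma liouville_Q i f : liouville (Q i f) = Q i (liouville f) - Q i f.
Proof. by rewrite Q_liouville addrC addKr. Qed.

(** Jacobi identity for three horizontal fields: [hor_comm], read backwards on the N^p_i, turns each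
    sum into second horizontal derivatives, and the twelve terms cancel in pairs. *)
Lemma bianchi2 i j l p :
  hor i (curv p j l) + (\sum_m curv m j l * Q m (nonlin p i)) +
  (hor j (curv p l i) + (\sum_m curv m l i * Q m (nonlin p j))) +
  (hor l (curv p i j) + (\sum_m curv m i j * Q m (nonlin p l))) = 0.
Proof. by rewrite -!hor_comm /curv !hB; ring. Qed.

Lemma Q_curv i k j l : Q i (curv k j l) =
  hor l (Q i (nonlin k j)) - (\sum_m Q i (nonlin m l) * Q m (nonlin k j)) -
  (hor j (Q i (nonlin k l)) - \sum_m Q i (nonlin m j) * Q m (nonlin k l)).
Proof. by rewrite -!Q_hor -QB. Qed.

(** By symmetry of the Berwald coefficients, both their horizontal derivatives and their quadratic
    terms cancel in the cyclic sum. *)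
Lemma bianchi1 k i j l : Q i (curv k j l) + Q j (curv k l i) + Q l (curv k i j) = 0.
Proof.
rewrite !Q_curv.
have e a b c : \sum_k0 Q a (nonlin k0 b) * Q k0 (nonlin k c) =
  \sum_k0 Q b (nonlin k0 a) * Q k0 (nonlin k c).
  by apply: eq_bigr => m _; rewrite nonlinC.
rewrite (nonlinC k l i) (nonlinC k l j) (nonlinC k j i).
rewrite (e l i) (e l j) (e j i); ring.
Qed.

(** * Homogeneous sprays: contractions of the curvature *)

Section Homogeneous.
Hypothesis CG : forall i, liouville (G i) = 2 * G i.

Lemma liouville_nonlin i j : liouville (nonlin i j) = nonlin i j.
Proof. by rewrite /nonlin liouville_Q CG derivationMnl //; ring. Qed.

Lemma sum_y_nonlin k : \sum_i y i * nonlin k i = 2 * G k.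
Proof. by rewrite -CG. Qed.

(** A homogeneous spray is horizontal, because Euler's relation gives y^i N^k_i = 2 G^k. *)
Lemma spray_hor f : spray f = \sum_i y i * hor i f.
Proof.
rewrite /spray /hor.
under [RHS]eq_bigr => i _ do rewrite mulrBr mulr_sumr.
rewrite sumrB exchange_big /=; congr (_ - _); apply: eq_bigr => k _.
by rewrite -sum_y_nonlin mulr_suml; apply: eq_bigr => i _; rewrite mulrA.
Qed.

Lemma liouville_hor i f : liouville (hor i f) = hor i (liouville f).
Proof.
rewrite {1}/hor CB Cs /hor P_liouville; congr (_ - _); apply: eq_bigr => k _.
rewrite CM liouville_nonlin Q_liouville; ring.
Qed.

Lemma liouville_curv k i j : liouville (curv k i j) = curv k i j.
Proof. by rewrite /curv CB !liouville_hor !liouville_nonlin. Qed.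

(** This is i_S R = Phi. The quadratic term of Phi appears when delta_j falls on y^i in y^i N^k_i =
    2 G^k, since delta_j y^i = - N^i_j. *)
Lemma sum_y_curv k j : \sum_i y i * curv k i j = jacobi k j.
Proof.
rewrite /jacobi spray_hor /curv.
under eq_bigr => i _ do rewrite mulrBr.
rewrite sumrB.
have : hor j (2 * G k) = \sum_i y i * hor j (nonlin k i) -
   \sum_i nonlin k i * nonlin i j.
  rewrite -sum_y_nonlin hs -sumrB; apply: eq_bigr => i _.
  by rewrite hM hor_y; ring.
rewrite derivationMnl; last exact: derivation_hor.
by move=> ->; ring.
Qed.

Lemma curvC k i j : curv k j i = - curv k i j.
Proof. exact: (esym (opprB _ _)). Qed.

(* This is 3 R = [J, Phi]. *)
Lemma curv_jacobi k i j : 3 * curv k i j = Q i (jacobi k j) - Q j (jacobi k i).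
Proof.
rewrite -!sum_y_curv !Qs.
have e a b : \sum_l Q a (y l * curv k l b) = curv k a b + \sum_l y l * Q a (curv k l b).
  rewrite -[X in _ = X + _](sum_delta (curv k ^~ b)) -big_split.
  by apply: eq_bigr => l _ /=; rewrite QM Qy mulrC.
rewrite !e (curvC k i j).
(* Euler's relation for R, of degree 1, where [bianchi1] moves the derivative from d/dy^l to d/dy^i
   and d/dy^j. *)
have h : curv k i j =
    \sum_l y l * Q i (curv k l j) - \sum_l y l * Q j (curv k l i).
  have {1}<- := liouville_curv k i j.
  rewrite /liouville -sumrB; apply: eq_bigr => l _; rewrite -mulrBr.
  congr (_ * _); have /(congr1 (fun x => x + Q i (curv k l j) - Q j (curv k l i))) :=
    bianchi1 k i j l.
  by rewrite (curvC k l j) (derivationN (dQ i)) add0r => <-; ring.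
(* Two copies come from differentiating the factors y^l, the third from [h]. *)
transitivity (curv k i j + curv k i j + curv k i j); first by ring.
by rewrite {3}h; ring.
Qed.

Lemma liouville_jacobi k j : liouville (jacobi k j) = 2 * jacobi k j.
Proof.
rewrite -sum_y_curv Cs mulr_sumr; apply: eq_bigr => i _.
by rewrite CM liouville_y liouville_curv; ring.
Qed.

End Homogeneous.

(** * The spray of an energy function *)

Section Finsler.
Variable E : A.
Hypotheses (CE : liouville E = 2 * E) (EL : forall j, spray (Q j E) = P j E).
Hypotheses (Ereg : forall x, E * x = 0 -> x = 0)
  (natreg : forall m (x : A), (0 < m)%N -> m%:R * x = 0 -> x = 0)
  (nondeg : forall c : 'I_n -> A,
     (forall k, \sum_i c i * Q i (Q k E) = 0) -> forall i, c i = 0).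

Lemma natI m (a b : A) : (0 < m)%N -> m%:R * a = m%:R * b -> a = b.
Proof.
move=> m0 ab; apply/eqP; rewrite -subr_eq0; apply/eqP/(natreg m0).
by rewrite mulrBr ab subrr.
Qed.

Lemma sum_y_QE : \sum_i y i * Q i E = 2 * E. Proof. exact: CE. Qed.

Lemma liouville_QE j : liouville (Q j E) = Q j E.
Proof. by rewrite liouville_Q CE derivationMnl //; ring. Qed.

Lemma liouville_spray_QE j : liouville (\sum_i y i * P i (Q j E)) =
  2 * \sum_i y i * P i (Q j E).
Proof.
rewrite Cs mulr_sumr; apply: eq_bigr => i _.
by rewrite CM liouville_y -P_liouville liouville_QE; ring.
Qed.

(* Nondegeneracy determines the G^i from E, hence their homogeneity. *)
Lemma liouville_G i : liouville (G i) = 2 * G i.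
Proof.
apply/eqP; rewrite -subr_eq0; apply/eqP.
apply: (nondeg (c := fun i => liouville (G i) - 2 * G i)) => k.
apply: (natreg (m := 2)) => //.
(* In this form of the spray equation the right-hand side has degree 2 and the Hessian degree 0.
   Applying the Liouville field thus shows that the Hessian annihilates the defect of homogeneity of
   the G^i. *)
have e : \sum_i 2 * G i * Q i (Q k E) = \sum_i y i * P i (Q k E) - P k E.
  by rewrite -EL /spray; ring.
have := congr1 liouville e; rewrite Cs CB liouville_spray_QE -P_liouville CE.
rewrite derivationMnl // -mulrBr -e.
have -> : \sum_i liouville (2 * G i * Q i (Q k E)) =
   2 * \sum_i liouville (G i) * Q i (Q k E).
  rewrite mulr_sumr; apply: eq_bigr => j _.
  rewrite CM (derivationMnl derivation_liouville).
  by rewrite liouville_Q liouville_QE; ring.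
move=> h.
under eq_bigr => j _ do rewrite mulrBl.
rewrite sumrB mulrBr h; ring.
Qed.

(** Applying S to Euler's relation y^j E_j = 2 E gives S(E) on the left, by [EL] and [spray_y], and
    2 S(E) on the right. *)
Lemma spray_E : spray E = 0.
Proof.
have /(congr1 spray) : \sum_j y j * Q j E = 2 * E by exact: CE.
rewrite Ss derivationMnl; last exact: derivation_spray.
have -> : \sum_j spray (y j * Q j E) = spray E.
  rewrite {2}/spray -sumrB; apply: eq_bigr => j _.
  by rewrite SM EL spray_y; ring.
by move/(congr1 (fun x => x - spray E)); rewrite subrr => h; rewrite h; ring.
Qed.

(** The y^j-derivative of S(E) = 0 and the equation [EL] contain the same second derivatives of E;
    eliminating these leaves 2 delta_j E = 0. *)
Lemma hor_E j : hor j E = 0.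
Proof.
apply: (natreg (m := 2)) => //.
have := congr1 (Q j) spray_E; rewrite derivation0 // {1}/spray QB !Qs.
have -> : \sum_i Q j (y i * P i E) = P j E + \sum_i y i * P i (Q j E).
  rewrite -[X in _ = X + _](sum_delta (P ^~ E)) -big_split.
  by apply: eq_bigr => i _ /=; rewrite QM Qy QP mulrC.
have -> : \sum_i Q j (2 * G i * Q i E) = 2 * (\sum_i nonlin i j * Q i E) +
   \sum_i 2 * G i * Q i (Q j E).
  rewrite mulr_sumr -big_split; apply: eq_bigr => i _ /=.
  by rewrite QM derivationMnl // QQ /nonlin; ring.
have := EL j; rewrite /spray /hor.
move: (\sum_i _) (\sum_i _) (\sum_i _) => c b a h1 h2.
transitivity ((P j E + a - (2 * c + b)) + (P j E - (a - b))); first by ring.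
by rewrite h1 h2 subrr addr0.
Qed.

Lemma hor_QE i j : hor i (Q j E) = \sum_m Q j (nonlin m i) * Q m E.
Proof.
have := Q_hor j i E; rewrite hor_E derivation0 // => /esym/eqP.
by rewrite subr_eq0 => /eqP.
Qed.

Let CG := liouville_G.

Definition trjacobi := \sum_i jacobi i i.

Lemma liouville_trjacobi : liouville trjacobi = 2 * trjacobi.
Proof.
by rewrite Cs mulr_sumr; apply: eq_bigr => i _; rewrite liouville_jacobi.
Qed.

(** Since 2 F dF/dy^j = E_j, the factor 2 in the hypothesis avoids halves. In 3 R = [J, Phi] the
    Hessian terms cancel, while E_i delta^k_j - E_j delta^k_i occurs twice from the first summand
    and once from the second, which compensates the 3. The trace gives t = (n - 1) c E. *)
Lemma cfc_curv c (Qc : forall i, Q i c = 0) :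
  (forall i j, 2 * jacobi i j = c * (2 * E * (i == j)%:R - Q j E * y i)) ->
  forall k i j, (2 * (n%:R - 1)) * curv k i j =
    Q i trjacobi * (k == j)%:R - Q j trjacobi * (k == i)%:R.
Proof.
move=> hc k i j.
have trE : trjacobi = (n%:R - 1) * c * E.
  apply: (natI (m := 2)) => //; rewrite mulr_sumr.
  under eq_bigr => l _ do rewrite hc eqxx mulr1 mulrBr.
  rewrite sumrB sumr_const card_ord -mulr_sumr.
  have -> : \sum_l Q l E * y l = 2 * E.
    by rewrite -sum_y_QE; apply: eq_bigr => l _; rewrite mulrC.
  by rewrite -mulr_natl; ring.
have QtrE l : Q l trjacobi = (n%:R - 1) * c * Q l E.
  by rewrite trE !QM Qc QB (derivation_nat (dQ l)) (derivation1 (dQ l)); ring.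
apply: (natI (m := 3)) => //; rewrite mulrCA curv_jacobi //.
have Qj a b d : 2 * Q a (jacobi b d) = c * (2 * Q a E * (b == d)%:R -
   (Q a (Q d E) * y b + Q d E * (a == b)%:R)).
  by rewrite -(derivationMnl (dQ a)) hc QM Qc QB !QM Qy !(derivation_nat (dQ a)); ring.
transitivity ((n%:R - 1) * (2 * Q i (jacobi k j) - 2 * Q j (jacobi k i))).
  by ring.
rewrite !Qj !QtrE (QQ i j) (eq_sym i k) (eq_sym j k); ring.
Qed.

Hypothesis n_ge3 : (3 <= n)%N.
Local Notation t := trjacobi.
Hypothesis isotropic : forall k i j, (2 * (n%:R - 1)) * curv k i j =
    Q i t * (k == j)%:R - Q j t * (k == i)%:R.

Let n1E : n%:R - 1 = n.-1%:R :> A.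
Proof. by case: n n_ge3 => // m _; rewrite -natr1 addrK. Qed.

(** The bracket of delta_i and delta_j kills E, so R^k_ij E_k = 0; then [isotropic] is inserted. *)
Lemma Qtrjacobi_QE i j : Q i t * Q j E = Q j t * Q i E.
Proof.
have := hor_comm i j E; rewrite !hor_E !(derivation0 (derivation_hor _)) subrr.
move=> /esym /(congr1 (fun x => 2 * (n%:R - 1) * x)); rewrite mulr0 mulr_sumr.
under eq_bigr => k _ do rewrite mulrA isotropic mulrBl mulrAC [X in _ - X]mulrAC.
by rewrite sumrB !sum_delta' => /eqP; rewrite subr_eq0 => /eqP.
Qed.

(** Contraction of [Qtrjacobi_QE] with y^j, both t and E having degree 2. It says that t / E does
    not depend on y. *)
Lemma E_Qtrjacobi i : E * Q i t = t * Q i E.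
Proof.
apply: (natI (m := 2)) => //; rewrite !mulrA -sum_y_QE -liouville_trjacobi //.
rewrite mulr_suml /liouville mulr_suml; apply: eq_bigr => j _.
by rewrite -!mulrA; congr (_ * _); rewrite mulrC Qtrjacobi_QE.
Qed.

(** Contraction of [isotropic] with y; the factor E serves to replace E t_j by t E_j. *)
Lemma jacobi_isotropic i j :
  2 * (n%:R - 1) * E * jacobi i j = t * (2 * E * (i == j)%:R - Q j E * y i).
Proof.
rewrite -sum_y_curv // mulrAC mulr_sumr.
under eq_bigr => l _ do rewrite mulrCA isotropic mulrBr !mulrA.
rewrite sumrB sum_delta -mulr_suml.
have -> : \sum_i0 y i0 * Q i0 t = 2 * t by exact: liouville_trjacobi.
transitivity (2 * t * (i == j)%:R * E - y i * (E * Q j t)); first by ring.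
by rewrite E_Qtrjacobi; ring.
Qed.

Lemma hor_QtrjacobiC i j : hor i (Q j t) = hor j (Q i t).
Proof.
have [->//|ij] := eqVneq i j.
(* In the coefficient k = l of the Bianchi identity, with l distinct from i and
   j, all terms but two vanish or cancel. *)
have [l li lj] := exists_neq2 n_ge3 i j.
(* The constant 2 (n - 1) is made opaque, retaining only that it clears the curvature and commutes
   with horizontal derivatives. *)
have [c iso hn] : exists2 c : A, forall k i j,
    c * curv k i j = Q i t * (k == j)%:R - Q j t * (k == i)%:R &
    forall k f, c * hor k f = hor k (c * f).
  exists (2 * (n%:R - 1)) => // k f.
  by rewrite n1E -!mulrA !(derivationMnl (derivation_hor k)).
have := congr1 ( *%R c) (bianchi2 i j l l); rewrite mulr0.
have cD a b d e f g : c * (a + b + (d + e) + (f + g)) =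
    c * a + c * b + (c * d + c * e) + (c * f + c * g) by ring.
rewrite cD !hn !iso !mulr_sumr {cD}.
have isoE a b d : \sum_m c * (curv m a b * Q m (nonlin l d)) =
    Q a t * Q b (nonlin l d) - Q b t * Q a (nonlin l d).
  under eq_bigr => m _ do rewrite mulrA iso mulrBl mulrAC [X in _ - X]mulrAC.
  by rewrite sumrB !sum_delta'.
rewrite !isoE {isoE}.
rewrite eqxx (negbTE li) (negbTE lj) !mulr0 !mulr1 !subr0 !sub0r.
rewrite (derivationN (derivation_hor _)) (derivation0 (derivation_hor _)).
rewrite (nonlinC l l i) (nonlinC l l j) (nonlinC l j i) => h.
by apply/eqP; rewrite -subr_eq0 -h; apply/eqP; ring.
Qed.

(** Apply delta_i to E t_j = t E_j. The terms t delta_i E_j are symmetric in [i] and [j] by [hor_QE]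
    and drop out against [hor_QtrjacobiC]. *)
Lemma hor_trjacobi_QE i j : hor i t * Q j E = hor j t * Q i E.
Proof.
have e a b : E * hor a (Q b t) = hor a t * Q b E + t * hor a (Q b E).
  by rewrite -hM -E_Qtrjacobi hM hor_E mul0r add0r.
have := congr1 ( *%R E) (hor_QtrjacobiC i j); rewrite !e !hor_QE.
have -> : \sum_m Q j (nonlin m i) * Q m E = \sum_m Q i (nonlin m j) * Q m E.
  by apply: eq_bigr => m _; rewrite nonlinC.
exact: addIr.
Qed.

(** Thus (delta_i t) / E does not depend on y either. The Berwald terms of [Q_hor] are absorbed by
    [hor_QE]. *)
Lemma E_Qhor_trjacobi k i : E * Q k (hor i t) = hor i t * Q k E.
Proof.
rewrite Q_hor mulrBr mulr_sumr.
under eq_bigr => m _ do rewrite mulrCA E_Qtrjacobi mulrCA.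
rewrite -mulr_sumr -hor_QE.
have -> : E * hor i (Q k t) = hor i (E * Q k t) by rewrite hM hor_E mul0r add0r.
by rewrite E_Qtrjacobi hM; ring.
Qed.

Lemma hor_trjacobi i : hor i t = 0.
Proof.
(* The y^k-derivative of [hor_trjacobi_QE], times E: by [E_Qhor_trjacobi] the terms with derivatives
   of delta_i t form a multiple of [hor_trjacobi_QE] itself. *)
have e j k : hor i t * Q k (Q j E) = hor j t * Q k (Q i E).
  apply/eqP; rewrite -subr_eq0; apply/eqP/Ereg.
  have /(congr1 (Q k)) := hor_trjacobi_QE i j; rewrite !QM => /eqP.
  rewrite -subr_eq0 => /eqP; set d := _ - _ => d0.
  transitivity (E * d - E * Q k (hor i t) * Q j E + E * Q k (hor j t) * Q i E).
    by rewrite /d; ring.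
  rewrite d0 !E_Qhor_trjacobi.
  transitivity (- Q k E * (hor i t * Q j E - hor j t * Q i E)); first by ring.
  by rewrite hor_trjacobi_QE subrr mulr0.
have [j ji] : exists j : 'I_n, j != i.
  by have [j] := exists_neq2 n_ge3 i i; exists j.
(* By [e] this vector is in the kernel of the Hessian; its j-th component is delta_i t because j
   differs from i. *)
pose c l := hor i t * (l == j)%:R - hor j t * (l == i)%:R.
have : c j = 0.
  apply: nondeg => k; rewrite /c.
  under eq_bigr => l _ do rewrite mulrBl mulrAC [X in _ - X]mulrAC.
  by rewrite sumrB !sum_delta' (QQ j) (QQ i) e subrr.
by rewrite /c eqxx (negbTE ji) mulr0 mulr1 subr0.
Qed.

(** As t and E are horizontally constant, their x-derivatives are the combinations N^j_i t_j and
    N^j_i E_j, so proportionality passes from the y-derivatives to the x-derivatives. *)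
Lemma E_Ptrjacobi i : E * P i t = t * P i E.
Proof.
have := hor_trjacobi i; rewrite /hor => /eqP; rewrite subr_eq0 => /eqP ->.
have := hor_E i; rewrite /hor => /eqP; rewrite subr_eq0 => /eqP ->.
rewrite !mulr_sumr; apply: eq_bigr => j _; rewrite mulrCA E_Qtrjacobi; ring.
Qed.

End Finsler.
End Spray.

(* [pull] stands for the pull-back of functions along the change of induced
   coordinates (x, y) |-> (phi(x), phi'(x) y) and [J k i] for dphi^k/dh^i. *)
Section ChangeOfCoordinates.
Variables (A B : comPzRingType) (n : nat).
Variables (P Q : 'I_n -> A -> A) (y G : 'I_n -> A).
Variables (P' Q' : 'I_n -> B -> B) (y' G' : 'I_n -> B).
Hypotheses (dP : forall i, derivation (P i)) (dQ : forall i, derivation (Q i)).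
Hypotheses (PP : forall i j f, P i (P j f) = P j (P i f))
  (QP : forall i j f, Q i (P j f) = P j (Q i f))
  (QQ : forall i j f, Q i (Q j f) = Q j (Q i f)).
Hypotheses (Py : forall i j, P i (y j) = 0)
  (Qy : forall i j, Q i (y j) = (i == j)%:R).
Hypotheses (P'y : forall i j, P' i (y' j) = 0)
  (Q'y : forall i j, Q' i (y' j) = (i == j)%:R).
Variables (pull : {rmorphism B -> A}) (J : 'I_n -> 'I_n -> A).
Hypotheses
  (Qpull : forall i f, Q i (pull f) = \sum_k J k i * pull (Q' k f))
  (Ppull : forall i f, P i (pull f) =
     \sum_k J k i * pull (P' k f) + \sum_k P i (pull (y' k)) * pull (Q' k f))
  (pull_y : forall k, pull (y' k) = \sum_i J k i * y i)
  (QJ : forall i j k, Q i (J k j) = 0)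
  (PJ : forall i j k, P i (J k j) = P j (J k i))
  (spray_pull_y : forall k, spray P Q y G (pull (y' k)) = - (2 * pull (G' k)))
  (natreg : forall m (x : A), (0 < m)%N -> m%:R * x = 0 -> x = 0).

Local Notation N := (nonlin Q G).
Local Notation N' := (nonlin Q' G').
Local Notation dh := (hor P Q G).
Local Notation dh' := (hor P' Q' G').
Local Notation R := (curv P Q G).
Local Notation R' := (curv P' Q' G').
Let dhor i : derivation (dh i) := derivation_hor G dP dQ i.

Lemma Q_pull_y i k : Q i (pull (y' k)) = J k i.
Proof.
rewrite Qpull -[RHS](sum_delta' (J ^~ i)); apply: eq_bigr => l _.
by rewrite Q'y rmorph_nat.
Qed.

(** The y^j-derivative of the transformation law [spray_pull_y] of the G^i. The last term is the
    failure of N to be a tensor. *)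
Lemma nonlin_pull j k :
  \sum_l J l j * pull (N' k l) = \sum_i N i j * J k i - P j (pull (y' k)).
Proof.
rewrite -Qpull.
apply: (natI natreg (m := 2)) => //.
have /eqP := spray_pull_y k; rewrite -eqr_oppLR => /eqP.
move/(congr1 (Q j)); rewrite (derivationMnl (dQ j)) => <-.
rewrite /spray opprB (derivationB (dQ j)) !(derivation_sum (dQ j)).
have -> : \sum_i Q j (2 * G i * Q i (pull (y' k))) = 2 * \sum_i N i j * J k i.
  rewrite mulr_sumr; apply: eq_bigr => i _.
  rewrite (derivationM (dQ j)) (derivationMnl (dQ j)) Q_pull_y QJ mulr0 addr0.
  by rewrite mulrA.
rewrite mulrBr; congr (_ - _).
have -> : \sum_i Q j (y i * P i (pull (y' k))) =
  P j (pull (y' k)) + \sum_i y i * P j (J k i).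
  rewrite -[X in _ = X + _](sum_delta (fun i => P i (pull (y' k)))) -big_split.
  apply: eq_bigr => i _ /=; rewrite (derivationM (dQ j)) Qy QP Q_pull_y PJ.
  by rewrite mulrC.
have -> : \sum_i y i * P j (J k i) = P j (pull (y' k)).
  rewrite pull_y (derivation_sum (dP j)); apply: eq_bigr => i _.
  by rewrite (derivationM (dP j)) Py mulr0 addr0 mulrC.
ring.
Qed.

(** The non-tensorial terms of [Ppull] and of [nonlin_pull] cancel. *)
Lemma hor_pull j f : dh j (pull f) = \sum_k J k j * pull (dh' k f).
Proof.
rewrite /hor Ppull.
have -> : \sum_i N i j * Q i (pull f) =
    \sum_k (\sum_i N i j * J k i) * pull (Q' k f).
  under eq_bigr => i _ do rewrite Qpull mulr_sumr.
  rewrite exchange_big; apply: eq_bigr => k _ /=; rewrite mulr_suml.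
  by apply: eq_bigr => i _; rewrite mulrA.
rewrite -addrA -sumrB.
have -> : \sum_k (P j (pull (y' k)) * pull (Q' k f) -
     (\sum_i N i j * J k i) * pull (Q' k f)) =
   - \sum_k \sum_l J l j * pull (N' k l) * pull (Q' k f).
  rewrite -sumrN; apply: eq_bigr => k _; rewrite -mulr_suml nonlin_pull; ring.
rewrite exchange_big -sumrB; apply: eq_bigr => k _ /=.
rewrite rmorphB rmorph_sum mulrBr mulr_sumr; congr (_ - _).
by apply: eq_bigr => l _; rewrite rmorphM mulrA.
Qed.

Lemma hor_J i j k : dh i (J k j) = dh j (J k i).
Proof.
rewrite /hor !big1 ?subr0 // => l _; by rewrite QJ mulr0.
Qed.

(** Tensoriality of R: the bracket of delta_i and delta_j is applied to the pulled-back fibre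
    coordinate y'^k, whose vertical derivatives are the J^k_p and whose horizontal ones are minus
    the pulled-back N'. *)
Lemma curv_pull i j k : \sum_p R p i j * J k p =
  \sum_m \sum_l J m i * J l j * pull (R' k m l).
Proof.
under eq_bigr => p _ do rewrite -Q_pull_y.
rewrite -(hor_comm G dP dQ PP QP QQ).
have e a b : dh a (dh b (pull (y' k))) = - \sum_l dh a (J l b) * pull (N' k l)
    - \sum_m \sum_l J m a * J l b * pull (dh' m (N' k l)).
  rewrite hor_pull (derivation_sum (dhor a)) exchange_big -opprD -big_split -sumrN.
  apply: eq_bigr => l _ /=.
  rewrite hor_y // rmorphN mulrN (derivationN (dhor a)); congr (- _).
  rewrite (derivationM (dhor a)) hor_pull; congr (_ + _).
  by rewrite mulr_sumr; apply: eq_bigr => m _; rewrite mulrCA mulrA.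
rewrite !e.
have -> : \sum_l dh j (J l i) * pull (N' k l) =
   \sum_l dh i (J l j) * pull (N' k l).
  by apply: eq_bigr => l _; rewrite hor_J.
rewrite [X in _ - (_ - X)]exchange_big /=.
have -> : \sum_m \sum_l J m i * J l j * pull (R' k m l) =
   \sum_m \sum_l J m i * J l j * pull (dh' l (N' k m)) -
   \sum_m \sum_l J m i * J l j * pull (dh' m (N' k l)).
  rewrite -sumrB; apply: eq_bigr => m _; rewrite -sumrB; apply: eq_bigr => l _.
  by rewrite -mulrBr -rmorphB.
have -> : \sum_m \sum_l J l j * J m i * pull (dh' l (N' k m)) =
   \sum_m \sum_l J m i * J l j * pull (dh' l (N' k m)).
  by apply: eq_bigr => m _; apply: eq_bigr => l _; rewrite [J l j * _]mulrC.
ring.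
Qed.

Variables (E t : A) (E' t' : B).
Hypotheses (pullE : pull E' = E) (CE : \sum_i y i * Q i E = 2 * E)
  (Et : forall i, E * Q i t = t * Q i E)
  (Et' : forall i, E' * Q' i t' = t' * Q' i E')
  (isotropic : forall k i j, (2 * (n%:R - 1)) * R k i j =
    Q i t * (k == j)%:R - Q j t * (k == i)%:R)
  (isotropic' : forall k i j, (2 * (n%:R - 1)) * R' k i j =
    Q' i t' * (k == j)%:R - Q' j t' * (k == i)%:R).

(** Under isotropy both sides of [curv_pull], multiplied by 2 (n - 1) E, are a trace times the same
    tensor J^k_j E_i - J^k_i E_j; contraction with y^i gives the second factor. That factor is not
    cancelled here but studied pointwise in [kappa_trans]. *)
Lemma trace_pull k j : (t - pull t') * (2 * E * J k j - pull (y' k) * Q j E) = 0.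
Proof.
have e i : (t - pull t') * (J k j * Q i E - J k i * Q j E) = 0.
  have := congr1 (fun x => 2 * (n%:R - 1) * E * x) (curv_pull i j k).
  have -> : 2 * (n%:R - 1) * E * (\sum_p R p i j * J k p) =
      t * (J k j * Q i E - J k i * Q j E).
    transitivity (E * (J k j * Q i t - J k i * Q j t)).
      rewrite mulrAC mulrC mulr_sumr; congr (_ * _).
      under eq_bigr => p _ do rewrite mulrA isotropic mulrBl mulrAC [X in _ - X]mulrAC.
      rewrite sumrB !sum_delta'; ring.
    transitivity (J k j * (E * Q i t) - J k i * (E * Q j t)); first by ring.
    by rewrite !Et; ring.
  have -> : 2 * (n%:R - 1) * E * (\sum_m \sum_l J m i * J l j * pull (R' k m l)) =
      pull t' * (J k j * Q i E - J k i * Q j E).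
    have f m l : 2 * (n%:R - 1) * E * (J m i * J l j * pull (R' k m l)) = pull t' *
         (J m i * pull (Q' m E') * (J l j * (k == l)%:R) -
         J m i * (k == m)%:R * (J l j * pull (Q' l E'))).
      (* The factor E, being the pull-back of E', enters the pull-back, where E' t'_m becomes t'
         E'_m. *)
      have h : E * 2 * (n%:R - 1) * pull (R' k m l) =
          pull t' * (pull (Q' m E') * (k == l)%:R - pull (Q' l E') * (k == m)%:R).
        rewrite -pullE -!(rmorph_nat pull) -(rmorph1 pull) -!(rmorphB, rmorphM).
        congr (pull _).
        transitivity (E' * (2 * (n%:R - 1) * R' k m l)); first by ring.
        rewrite isotropic'.
        transitivity (E' * Q' m t' * (k == l)%:R - E' * Q' l t' * (k == m)%:R).
          by ring.
        by rewrite !Et'; ring.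
      transitivity (J m i * J l j * (E * 2 * (n%:R - 1) * pull (R' k m l))).
        by ring.
      rewrite h; ring.
    rewrite mulr_sumr.
    under eq_bigr => m _.
      rewrite mulr_sumr; under eq_bigr => l _ do rewrite f.
      rewrite -mulr_sumr sumrB -!mulr_sumr sum_delta; over.
    rewrite -mulr_sumr sumrB -!mulr_suml sum_delta -!Qpull pullE.
    by ring.
  by move=> h; rewrite mulrBl h subrr.
transitivity (\sum_i y i * ((t - pull t') * (J k j * Q i E - J k i * Q j E))).
  under eq_bigr => i _ do rewrite mulrCA.
  rewrite -mulr_sumr; congr (_ * _).
  under eq_bigr => i _ do rewrite mulrBr.
  rewrite sumrB pull_y mulr_suml -CE mulr_suml.
  by congr (_ - _); apply: eq_bigr => i _; ring.
by rewrite big1 // => i _; rewrite e mulr0.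
Qed.

End ChangeOfCoordinates.

(** * Symmetry of second derivatives and smooth functions *)

Section Lines.
Variables (R : realType) (V : normedModType R).
Implicit Types (f : V -> R) (p u v w : V).

Lemma is_derive_line f p w (r : R) : differentiable f (p + r *: w) ->
  is_derive r (1 : R) (fun s : R => f (p + s *: w)) ('D_w f (p + r *: w)).
Proof.
move=> df; have dw : derivable f (p + r *: w) w := diff_derivable df.
have e : (fun h : R => h^-1 *: (((fun s : R => f (p + s *: w)) \o shift r) (h *: 1)
    - f (p + r *: w))) =
    (fun h : R => h^-1 *: ((f \o shift (p + r *: w)) (h *: w) - f (p + r *: w))).
  apply/funext => h /=; congr (_ *: (f _ - _)).
  by rewrite scaler1 scalerDl addrCA.
by split; [rewrite /derivable e|rewrite /derive e].
Qed.

Lemma mvt_line f p w (h : R) : 0 < h ->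
  (forall r, 0 <= r <= h -> differentiable f (p + r *: w)) ->
  exists2 r, 0 <= r <= h & f (p + h *: w) - f p = h * 'D_w f (p + r *: w).
Proof.
move=> h0 df.
have [||r] := @MVT _ (fun s : R => f (p + s *: w)) (fun s => 'D_w f (p + s *: w)) 0 h h0.
- move=> r; rewrite in_itv /= => /andP[r0 rh]; apply: is_derive_line.
  by apply: df; rewrite !ltW.
- apply: derivable_within_continuous => r; rewrite in_itv /= => rh.
  by have [] := is_derive_line (df r rh).
rewrite in_itv /= => /andP[r0 rh]; rewrite scale0r addr0 subr0 => e.
by exists r; rewrite ?e 1?mulrC // !ltW.
Qed.

Lemma derive_shift_line f p u w : 'D_u (fun q => f (q + w)) p = 'D_u f (p + w).
Proof.
have e : (fun h : R => h^-1 *: (((fun q => f (q + w)) \o shift p) (h *: u) - f (p + w))) =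
    (fun h : R => h^-1 *: ((f \o shift (p + w)) (h *: u) - f (p + w))).
  by apply/funext => h /=; rewrite addrA.
by rewrite /derive e.
Qed.

Lemma near_parallelogram p u v (P : set V) : (\near p, P p) ->
  exists2 h : R, 0 < h & forall s t, 0 <= s <= h -> 0 <= t <= h ->
    P (p + s *: u + t *: v).
Proof.
move=> /nbhs_ballP [e /= e0 eP].
(* The summand 1 keeps [c] positive when both vectors vanish. *)
pose c := `|u| + `|v| + 1.
have c0 : 0 < c by rewrite ltr_wpDl // addr_ge0.
exists (e / c / 2) => [|s t /andP[s0 sh] /andP[t0 th]].
  by rewrite !divr_gt0.
apply: eP; rewrite -ball_normE /ball_ /= -addrA opprD addNKr normrN.
have h0 : 0 <= e / c / 2 := le_trans s0 sh.
have hp : 0 < e / c / 2 by rewrite !divr_gt0.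
set k := e / c / 2 in sh th h0 hp *.
have -> : e = k * (c * 2) by rewrite /k; field; rewrite gt_eqF.
apply: (@le_lt_trans _ _ (k * `|u| + k * `|v|)).
  rewrite (le_trans (ler_normD _ _)) // !normrZ !ger0_norm //.
  by rewrite lerD // ler_wpM2r.
rewrite -mulrDr ltr_pM2l //.
have := normr_ge0 u; have := normr_ge0 v; rewrite /c; lra.
Qed.

(** The mean value theorem is used twice: along [u] for the increment of f by h v, then along [v]
    for D_u f. *)
Lemma second_difference f x u v (h : R) : 0 < h ->
  (forall s t, 0 <= s <= h -> 0 <= t <= h ->
    differentiable f (x + s *: u + t *: v) /\
    differentiable ('D_u f) (x + s *: u + t *: v)) ->
  exists s t, [/\ 0 <= s <= h, 0 <= t <= h &
    f (x + h *: u + h *: v) - f (x + h *: u) - (f (x + h *: v) - f x) =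
    h * (h * 'D_v ('D_u f) (x + s *: u + t *: v))].
Proof.
move=> h0 H; pose g q := f (q + h *: v) - f q.
have hh : 0 <= h <= h by rewrite lexx ltW.
have zh : (0 : R) <= 0 <= h by rewrite lexx ltW.
have dg s : 0 <= s <= h ->
    differentiable (fun q => f (q + h *: v)) (x + s *: u) /\
    differentiable f (x + s *: u).
  move=> sh; split; last by have [] := H s 0 sh zh; rewrite scale0r addr0.
  apply: (@differentiable_comp _ _ _ _ (fun q => q + h *: v) f).
    by apply: differentiableD => //; exact: differentiable_cst.
  by have [] := H s h sh hh.
have [s sh gE] := @mvt_line g x u h h0 (fun s sh =>
  let: conj a b := dg s sh in differentiableB a b).
have [|t th fE] := @mvt_line ('D_u f) (x + s *: u) v h h0.
  by move=> t th; have [_ ?] := H s t sh th.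
exists s, t; split => //; rewrite -fE [LHS]gE; congr (_ * _).
have [d1 d2] := dg s sh.
by rewrite deriveB ?derive_shift_line //; exact: diff_derivable.
Qed.

(** Schwarz: one second difference equals h^2 times either mixed derivative, at two points of a
    small parallelogram, and continuity brings both values within e of those at x. *)
Lemma derive_comm f x u v :
  (\near x, differentiable f x) -> (\near x, differentiable ('D_u f) x) ->
  (\near x, differentiable ('D_v f) x) ->
  {for x, continuous ('D_v ('D_u f))} -> {for x, continuous ('D_u ('D_v f))} ->
  'D_v ('D_u f) x = 'D_u ('D_v f) x.
Proof.
move=> df du dv cuv cvu.
suff H (e : R) : 0 < e -> `|'D_v ('D_u f) x - 'D_u ('D_v f) x| <= e + e.
  apply/eqP; rewrite -subr_eq0 -normr_eq0 eq_le normr_ge0 andbT.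
  apply/ler_addgt0Pr => e e0; rewrite add0r [leRHS](splitr e).
  by apply: H; rewrite divr_gt0.
move=> e0; have /cvgrPdist_lt/(_ _ e0) nuv := cuv.
have /cvgrPdist_lt/(_ _ e0) nvu := cvu.
have [h h0 H] := near_parallelogram u v
  (filterI df (filterI (filterI du dv) (filterI nuv nvu))).
have [|s [t [sh th Huv]]] := @second_difference f x u v h h0.
  by move=> s t sh th; have [? [[? _] _]] := H s t sh th.
have [|t' [s' [th' sh' Hvu]]] := @second_difference f x v u h h0.
  by move=> s' t' sh' th'; have [] := H t' s' th' sh'; rewrite addrAC => ? [[]].
have [_ [_ [Huv' _]]] := H s t sh th.
have [_ [_ [_ Hvu']]] := H s' t' sh' th'.
have E : 'D_v ('D_u f) (x + s *: u + t *: v) = 'D_u ('D_v f) (x + s' *: u + t' *: v).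
  have h_neq0 : h != 0 by rewrite gt_eqF.
  apply: (mulfI h_neq0); apply: (mulfI h_neq0).
  have -> : x + s' *: u + t' *: v = x + t' *: v + s' *: u by exact: addrAC.
  apply: (etrans (esym Huv)); apply: (etrans _ Hvu).
  have -> : x + h *: v + h *: u = x + h *: u + h *: v by exact: addrAC.
  ring.
rewrite E in Huv'; rewrite (distrC _ ('D_u ('D_v f) _)) in Hvu'.
by rewrite (le_trans (ler_distD _ _ _) (lerD (ltW Huv') (ltW Hvu'))).
Qed.

End Lines.

(** * Closure properties of functions of class C^k *)

Section Ck.
Variables (R : realType) (V : normedModType R).
Implicit Types (U : set V).

Lemma near_open U x : open U -> U x -> \near x, U x.
Proof. by move=> oU Ux; apply: open_nbhs_nbhs. Qed.

Lemma near_eq_differentiable (W : normedModType R) (f g : V -> W) x :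
  (\near x, f x = g x) -> differentiable f x -> differentiable g x.
Proof.
move=> fg df; have fgx := nbhs_singleton fg.
have dg : g \o shift x = cst (g x) + 'd f x +o_ (0 : V) id.
  apply/eqaddoP => e e0; have /eqaddoP/(_ e e0) := diff_locally df.
  have fg0 : \forall h \near (0 : V), f (h + x) = g (h + x).
    move: fg; rewrite (near_shift 0) /=.
    by apply: filterS => h /=; rewrite subr0.
  by move: fg0; apply: filterS2 => h /= fgh; rewrite /= !fctE /= -fgh fgx.
have dgE : 'd g x = 'd f x :> (V -> W).
  exact: diff_unique (diff_continuous df) dg.
by apply/diff_locallyP; rewrite dgE; split => //; apply: diff_continuous.
Qed.

Lemma derive_eq_on (W : normedModType R) U (f g : V -> W) v x : open U ->
  {in U, f =1 g} -> U x -> 'D_v f x = 'D_v g x.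
Proof.
move=> oU fg Ux; apply: near_eq_derive.
by apply: filterS (near_open oU Ux) => y Uy; apply: fg; rewrite inE.
Qed.

Lemma Ck_on_eq (W : normedModType R) k U (f g : V -> W) : open U ->
  {in U, f =1 g} -> Ck_on k U f -> Ck_on k U g.
Proof.
move=> oU; elim: k f g => [|k IH] f g fg /=.
  move=> cf x Ux.
  have nfg : \near x, f x = g x.
    by apply: filterS (near_open oU Ux) => y Uy; apply: fg; rewrite inE.
  rewrite /prop_for /continuous_at -(nbhs_singleton nfg).
  by apply: cvg_trans (cf x Ux); apply: near_eq_cvg; apply: filterS nfg.
move=> [df Df]; split=> [x Ux|v].
  apply: near_eq_differentiable (df x Ux).
  by apply: filterS (near_open oU Ux) => y Uy; apply: fg; rewrite inE.
by apply: IH (Df v) => x; rewrite inE; apply: derive_eq_on.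
Qed.

Lemma Ck_onW (W : normedModType R) k U (f : V -> W) : Ck_on k.+1 U f -> Ck_on k U f.
Proof.
elim: k f => [|k IH] f [df Df]; first by move=> x /df /differentiable_continuous.
by split=> // v; apply: IH.
Qed.

Lemma Ck_on_cst (W : normedModType R) k U (c : W) : Ck_on k U (fun=> c).
Proof.
elim: k c => [|k IH] c; first by move=> x _; exact: cvg_cst.
split=> [x _|v]; first exact: differentiable_cst.
have -> : 'D_v (fun=> c) = (fun=> 0 : W) by apply/funext => x; exact: derive_cst.
exact: IH.
Qed.

Lemma Ck_onN k U (f : V -> R) : open U -> Ck_on k U f -> Ck_on k U (fun x => - f x).
Proof.
move=> oU; elim: k f => [|k IH] f; first by move=> cf x Ux; apply: cvgN; exact: cf.
move=> [df Df]; split=> [x Ux|v]; first exact: differentiableN (df x Ux).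
apply: Ck_on_eq oU _ (IH _ (Df v)) => x; rewrite inE => Ux.
by rewrite (deriveN (diff_derivable (df x Ux))).
Qed.

Lemma Ck_onD k U (f g : V -> R) : open U -> Ck_on k U f -> Ck_on k U g ->
  Ck_on k U (fun x => f x + g x).
Proof.
move=> oU; elim: k f g => [|k IH] f g.
  by move=> cf cg x Ux; apply: cvgD; [exact: cf|exact: cg].
move=> [df Df] [dg Dg]; split=> [x Ux|v].
  exact: differentiableD (df x Ux) (dg x Ux).
apply: Ck_on_eq oU _ (IH _ _ (Df v) (Dg v)) => x; rewrite inE => Ux.
by rewrite (deriveD (diff_derivable (df x Ux)) (diff_derivable (dg x Ux))).
Qed.

Lemma Ck_onM k U (f g : V -> R) : open U -> Ck_on k U f -> Ck_on k U g ->
  Ck_on k U (fun x => f x * g x).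
Proof.
move=> oU; elim: k f g => [|k IH] f g.
  by move=> cf cg x Ux; apply: cvgM; [exact: cf|exact: cg].
move=> kf kg; have [[df Df] [dg Dg]] := (kf, kg); split=> [x Ux|v].
  exact: differentiableM (df x Ux) (dg x Ux).
have := Ck_onD oU (IH _ _ (Ck_onW kf) (Dg v)) (IH _ _ (Ck_onW kg) (Df v)).
apply: Ck_on_eq => // x; rewrite inE => Ux.
by rewrite (deriveM (diff_derivable (df x Ux)) (diff_derivable (dg x Ux))).
Qed.

Lemma Ck_on_sum k U (I : Type) (r : seq I) (f : I -> V -> R) : open U ->
  (forall i, Ck_on k U (f i)) -> Ck_on k U (fun x => \sum_(i <- r) f i x).
Proof.
move=> oU Cf; elim: r => [|i r IH].
  rewrite (_ : (fun _ => _) = fun=> 0); last by apply/funext => x; rewrite big_nil.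
  exact: Ck_on_cst.
rewrite (_ : (fun _ => _) = fun x => f i x + \sum_(j <- r) f j x).
  exact: Ck_onD.
by apply/funext => x; rewrite big_cons.
Qed.

Lemma smooth_on_derive (W : normedModType R) U (f : V -> W) v :
  smooth_on U f -> smooth_on U ('D_v f).
Proof. by move=> sf k; have [_ Df] := sf k.+1; exact: Df. Qed.

Lemma smooth_on_differentiable (W : normedModType R) U (f : V -> W) x :
  smooth_on U f -> U x -> differentiable f x.
Proof. by move=> sf Ux; have [df _] := sf 1%N; exact: df. Qed.

Lemma smooth_on_sub (W : normedModType R) U U' (f : V -> W) :
  U' `<=` U -> smooth_on U f -> smooth_on U' f.
Proof.
move=> UU' sf k; elim: k f sf => [|k IH] f sf.
  by move=> x /UU'; exact: (sf 0%N).
split=> [x /UU'|v]; first exact: smooth_on_differentiable.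
exact/IH/smooth_on_derive.
Qed.

End Ck.

Section Linear.
Variables (R : realType) (V W X : normedModType R).

Lemma derive_linear_comp (L : {linear W -> X}) (f : V -> W) x v :
  continuous L -> differentiable f x -> 'D_v (L \o f) x = L ('D_v f x).
Proof.
move=> cL df; have dL : differentiable L (f x) by exact: linear_differentiable.
rewrite (deriveE _ (differentiable_comp df dL)) (diff_comp df dL) /=.
by rewrite (diff_lin _ cL) deriveE.
Qed.

Lemma derive_comp_linear (L : {linear V -> W}) (f : W -> X) x v :
  'D_v (f \o L) x = 'D_(L v) f (L x).
Proof.
have e : (fun h : R => h^-1 *: (((f \o L) \o shift x) (h *: v) - (f \o L) x)) =
    (fun h : R => h^-1 *: ((f \o shift (L x)) (h *: L v) - f (L x))).
  by apply/funext => h /=; rewrite linearPZ.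
by rewrite /derive e.
Qed.

Lemma smooth_on_linear_comp (L : {linear W -> X}) (U : set V) (f : V -> W) :
  continuous L -> open U -> smooth_on U f -> smooth_on U (L \o f).
Proof.
move=> cL oU sf k; have D g x : smooth_on U g -> U x -> differentiable (L \o g) x.
  move=> sg Ux; apply: differentiable_comp; last exact: linear_differentiable.
  exact: smooth_on_differentiable sg Ux.
elim: k f sf => [|k IH] f sf.
  by move=> x Ux; apply: differentiable_continuous; exact: D.
split=> [x Ux|v]; first exact: D.
apply: Ck_on_eq oU _ (IH _ (smooth_on_derive v sf)) => x; rewrite inE => Ux /=.
by rewrite (derive_linear_comp _ cL) //; exact: smooth_on_differentiable sf Ux.
Qed.

Lemma smooth_on_comp_linear (L : {linear V -> W}) (U : set W) (f : W -> X) :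
  continuous L -> smooth_on U f -> smooth_on (L @^-1` U) (f \o L).
Proof.
move=> cL sf k; have D g x : smooth_on U g -> U (L x) -> differentiable (g \o L) x.
  move=> sg Ux; apply: differentiable_comp; first exact: linear_differentiable.
  exact: smooth_on_differentiable sg Ux.
elim: k f sf => [|k IH] f sf.
  by move=> x Ux; apply: differentiable_continuous; exact: D.
split=> [x Ux|v]; first exact: D.
rewrite (_ : 'D_v (f \o L) = 'D_(L v) f \o L); first exact/IH/smooth_on_derive.
by apply/funext => x; rewrite derive_comp_linear.
Qed.

End Linear.

Section Composition.
Variables (R : realType) (V W : normedModType R) (I : finType).
Variables (U : set V) (U' : set W) (t : I -> V -> R) (b : I -> W) (T : V -> W).
Hypotheses (oU : open U) (TU : forall x, U x -> U' (T x))
  (TE : forall x, U x -> T x = \sum_i t i x *: b i)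
  (st : forall i, smooth_on U (t i)).

Let T' x := \sum_i t i x *: b i.

Lemma comb_differentiable x : U x ->
  differentiable T x /\ forall v, 'D_v T x = \sum_i 'D_v (t i) x *: b i.
Proof.
move=> Ux.
have dt i : differentiable (t i) x := smooth_on_differentiable (st i) Ux.
have dT' : differentiable T' x /\ forall v, 'D_v T' x = \sum_i 'D_v (t i) x *: b i.
  rewrite /T'; elim: (index_enum I) => [|i r [IHd IH]].
    rewrite (_ : (fun _ => _) = cst 0); last by apply/funext => z; rewrite big_nil.
    by split=> [|v]; [exact: differentiable_cst|rewrite derive_cst big_nil].
  rewrite (_ : (fun _ => _) = (fun x => t i x *: b i) +
      fun x => \sum_(j <- r) t j x *: b j); last by apply/funext => z; rewrite big_cons.
  have dti := differentiableZl (b i) (dt i).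
  split=> [|v]; first exact: differentiableD.
  rewrite (deriveD (diff_derivable dti) (diff_derivable IHd)) IH big_cons.
  by rewrite (deriveE _ dti) diffZl // -deriveE.
split.
  apply: near_eq_differentiable dT'.1.
  by apply: filterS (near_open oU Ux) => y /TE.
move=> v; rewrite -dT'.2; apply: derive_eq_on oU _ Ux => y.
by rewrite inE => /TE.
Qed.

Variable f : W -> R.
Hypothesis sf : smooth_on U' f.

Lemma derive_comp_comb x v : U x ->
  'D_v (f \o T) x = \sum_i 'D_v (t i) x * 'D_(b i) f (T x).
Proof.
move=> Ux; have [dT DT] := comb_differentiable Ux.
have df := smooth_on_differentiable sf (TU Ux).
rewrite (deriveE _ (differentiable_comp dT df)) (diff_comp dT df) /=.
rewrite -(deriveE _ dT) DT linear_sum; apply: eq_bigr => i _.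
by rewrite linearZ (deriveE _ df).
Qed.

End Composition.

(** Induction on the order, for all f at once: the chain rule writes a derivative of f o T as a sum
    of products of smooth coefficients with compositions of the same shape. Writing T with scalar
    coefficients reduces everything to real-valued products. *)
Lemma smooth_on_comp_comb (R : realType) (V W : normedModType R) (I : finType)
  (U : set V) (U' : set W) (t : I -> V -> R) (b : I -> W) (T : V -> W) (f : W -> R) :
  open U -> (forall x, U x -> U' (T x)) ->
  (forall x, U x -> T x = \sum_i t i x *: b i) ->
  (forall i, smooth_on U (t i)) -> smooth_on U' f -> smooth_on U (f \o T).
Proof.
move=> oU TU TE st sf k.
have D g x : smooth_on U' g -> U x -> differentiable (g \o T) x.
  move=> sg Ux; apply: differentiable_comp.
    by have [] := comb_differentiable oU TE st Ux.
  exact: smooth_on_differentiable sg (TU _ Ux).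
elim: k f sf => [|k IH] f sf.
  by move=> x Ux; apply: differentiable_continuous; exact: D.
split=> [x Ux|v]; first exact: D.
apply: (@Ck_on_eq _ _ _ _ _ (fun x => \sum_i 'D_v (t i) x * ('D_(b i) f \o T) x)) => //.
  move=> x; rewrite inE => Ux.
  by rewrite (derive_comp_comb oU TU TE st sf).
apply: Ck_on_sum => // i; apply: Ck_onM => //.
  exact: smooth_on_derive.
exact/IH/smooth_on_derive.
Qed.

(** * The ring of smooth functions on an open set *)

Section SmoothRing.
Variables (R : realType) (V : normedModType R) (U : set V) (oU : open U).

(** Derivatives act on total functions; the value 0 outside U is arbitrary, and since U is open it
    does not affect derivatives at its points. *)
Definition ext0 (f : {x | U x} -> R) (x : V) : R :=
  if pselect (U x) is left Ux then f (exist _ x Ux) else 0.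

(* Functions on the subtype of the points of [U], so that functions agreeing on
   [U] are equal. The otherwise unused proof of [open U] lets the ring structure
   of [smoothFct] be inferred. *)
Definition smooth_fct (_ : open U) : {pred {x | U x} -> R} :=
  [pred f | `[< smooth_on U (ext0 f) >]].

Lemma smooth_fct_subring : subring_closed (smooth_fct oU).
Proof.
split=> [|f g /asboolP sf /asboolP sg|f g /asboolP sf /asboolP sg];
  apply/asboolP => k.
- apply: (@Ck_on_eq _ _ _ _ _ (fun=> 1 : R)) => //; last exact: Ck_on_cst.
  by move=> x; rewrite inE /ext0; case: pselect.
- apply: Ck_on_eq oU _ (Ck_onD oU (sf k) (Ck_onN oU (sg k))).
  by move=> x; rewrite inE /ext0; case: pselect.
- apply: Ck_on_eq oU _ (Ck_onM oU (sf k) (sg k)).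
  by move=> x; rewrite inE /ext0; case: pselect.
Qed.

Record smoothFct := SmoothFct {
  smooth_val : {x | U x} -> R; _ : smooth_val \in smooth_fct oU }.
HB.instance Definition _ := [isSub for smooth_val].
HB.instance Definition _ := [Choice of smoothFct by <:].
HB.instance Definition _ :=
  GRing.SubChoice_isSubComPzRing.Build _ (smooth_fct oU) smoothFct smooth_fct_subring.

Definition ev (a : smoothFct) : V -> R := ext0 (smooth_val a).

Lemma ev_smooth a : smooth_on U (ev a).
Proof. by case: a => f sf; exact/asboolP. Qed.

Lemma evE a x (Ux : U x) : ev a x = smooth_val a (exist _ x Ux).
Proof.
rewrite /ev /ext0; case: pselect => // Ux'.
by congr (smooth_val a (exist _ _ _)); exact: Prop_irrelevance.
Qed.

Lemma ev_inj a b : {in U, ev a =1 ev b} -> a = b.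
Proof.
move=> ab; apply: val_inj; apply/funext => -[x Ux] /=.
by rewrite -!evE; apply: ab; rewrite inE.
Qed.

Lemma evD a b x : U x -> ev (a + b) x = ev a x + ev b x.
Proof. by move=> Ux; rewrite !evE. Qed.
Lemma evN a x : U x -> ev (- a) x = - ev a x.
Proof. by move=> Ux; rewrite !evE. Qed.
Lemma evB a b x : U x -> ev (a - b) x = ev a x - ev b x.
Proof. by move=> Ux; rewrite evD ?evN. Qed.
Lemma evM a b x : U x -> ev (a * b) x = ev a x * ev b x.
Proof. by move=> Ux; rewrite !evE. Qed.
Lemma ev0 x : U x -> ev 0 x = 0.
Proof. by move=> Ux; rewrite !evE. Qed.
Lemma ev1 x : U x -> ev 1 x = 1.
Proof. by move=> Ux; rewrite !evE. Qed.
Lemma ev_nat m x : U x -> ev m%:R x = m%:R.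
Proof.
by move=> Ux; elim: m => [|m IH]; rewrite ?ev0 // -!natr1 evD // IH ev1.
Qed.
Lemma ev_sum (I : Type) (r : seq I) (f : I -> smoothFct) x : U x ->
  ev (\sum_(i <- r) f i) x = \sum_(i <- r) ev (f i) x.
Proof.
move=> Ux; elim: r => [|i r IH]; first by rewrite !big_nil ev0.
by rewrite !big_cons evD // IH.
Qed.

Lemma smooth_restr_subproof (f : V -> R) : smooth_on U f ->
  (fun x : {x | U x} => f (sval x)) \in smooth_fct oU.
Proof.
move=> sf; apply/asboolP => k; apply: Ck_on_eq oU _ (sf k) => x.
by rewrite inE /ext0; case: pselect.
Qed.

Definition smooth_restr (f : V -> R) (sf : smooth_on U f) : smoothFct :=
  SmoothFct (smooth_restr_subproof sf).

Lemma ev_smooth_restr f (sf : smooth_on U f) x : U x -> ev (smooth_restr sf) x = f x.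
Proof. by move=> Ux; rewrite evE. Qed.

Definition Dv (v : V) (a : smoothFct) : smoothFct :=
  smooth_restr (smooth_on_derive v (ev_smooth a)).

Lemma ev_Dv v a x : U x -> ev (Dv v a) x = 'D_v (ev a) x.
Proof. exact: ev_smooth_restr. Qed.

Lemma ev_differentiable a x : U x -> differentiable (ev a) x.
Proof. exact/smooth_on_differentiable/ev_smooth. Qed.

Lemma ev_Dv_eq v a f x : U x -> {in U, ev a =1 f} -> ev (Dv v a) x = 'D_v f x.
Proof. by move=> Ux af; rewrite ev_Dv //; exact: derive_eq_on oU af Ux. Qed.

Lemma derivation_Dv v : derivation (Dv v).
Proof.
split=> a b; apply: ev_inj => x; rewrite inE => Ux.
  have da := diff_derivable (v := v) (ev_differentiable a Ux).
  have db := diff_derivable (v := v) (ev_differentiable b Ux).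
  rewrite evD // !ev_Dv // -(deriveD da db); apply: derive_eq_on oU _ Ux => y.
  by rewrite inE => Uy; rewrite evD.
have da := diff_derivable (v := v) (ev_differentiable a Ux).
have db := diff_derivable (v := v) (ev_differentiable b Ux).
have -> : ev (Dv v (a * b)) x = 'D_v (ev a * ev b) x.
  by apply: ev_Dv_eq => // y; rewrite inE => Uy; rewrite evM.
rewrite evD // !evM // !ev_Dv // (deriveM da db) addrC mulrC.
by congr (_ + _); rewrite mulrC.
Qed.

Lemma Dv_comm u v a : Dv u (Dv v a) = Dv v (Dv u a).
Proof.
apply: ev_inj => x; rewrite inE => Ux.
have e w w' : ev (Dv w (Dv w' a)) x = 'D_w ('D_w' (ev a)) x.
  by apply: ev_Dv_eq => // y; rewrite inE => Uy; rewrite ev_Dv.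
have sa := ev_smooth a.
rewrite !e; apply: derive_comm.
- by apply: filterS (near_open oU Ux) => y; exact: smooth_on_differentiable.
- apply: filterS (near_open oU Ux) => y.
  exact/smooth_on_differentiable/smooth_on_derive.
- apply: filterS (near_open oU Ux) => y.
  exact/smooth_on_differentiable/smooth_on_derive.
- exact: (smooth_on_derive u (smooth_on_derive v sa) 0%N).
- exact: (smooth_on_derive v (smooth_on_derive u sa) 0%N).
Qed.

Definition smooth_cst (c : R) : smoothFct :=
  @smooth_restr (fun=> c) (fun k => Ck_on_cst k U c).

Lemma ev_smooth_cst c x : U x -> ev (smooth_cst c) x = c.
Proof. exact: ev_smooth_restr. Qed.

Lemma Dv_smooth_cst v c : Dv v (smooth_cst c) = 0.
Proof.
apply: ev_inj => x; rewrite inE => Ux; rewrite ev0 // (@ev_Dv_eq _ _ (cst c)) //.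
  exact: derive_cst.
by move=> y; rewrite inE => Uy; rewrite ev_smooth_cst.
Qed.

Lemma smoothFct_natreg m (a : smoothFct) : (0 < m)%N -> m%:R * a = 0 -> a = 0.
Proof.
move=> m0 ma; apply: ev_inj => x; rewrite inE => Ux.
have /(congr1 (fun b => ev b x)) := ma; rewrite evM // ev_nat // ev0 // => /eqP.
by rewrite mulf_eq0 pnatr_eq0 -leqn0 leqNgt m0 => /eqP.
Qed.

End SmoothRing.

(** * Pull-back as a ring morphism *)

Section Pullback.
Variables (R : realType) (V W : normedModType R) (U : set V) (oU : open U).
Variables (U' : set W) (oU' : open U') (T : V -> W) (TU : forall x, U x -> U' (T x)).
Variables (I : finType) (t : I -> smoothFct oU) (b : I -> W)
  (TE : forall x, U x -> T x = \sum_i ev (t i) x *: b i).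

Let st i := ev_smooth (t i).

Definition pull (a : smoothFct oU') : smoothFct oU :=
  smooth_restr oU (smooth_on_comp_comb oU TU TE st (ev_smooth a)).

Lemma ev_pull a x : U x -> ev (pull a) x = ev a (T x).
Proof. exact: ev_smooth_restr. Qed.

Lemma pull_is_additive : nmod_morphism pull.
Proof.
split.
  by apply: ev_inj => x; rewrite inE => Ux; rewrite ev_pull // !ev0 //; exact: TU.
move=> a c; apply: ev_inj => x; rewrite inE => Ux.
by rewrite evD // !ev_pull // evD //; exact: TU.
Qed.

Lemma pull_is_multiplicative : monoid_morphism pull.
Proof.
split.
  by apply: ev_inj => x; rewrite inE => Ux; rewrite ev_pull // !ev1 //; exact: TU.
move=> a c; apply: ev_inj => x; rewrite inE => Ux.
by rewrite evM // !ev_pull // evM //; exact: TU.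
Qed.

HB.instance Definition _ := GRing.isNmodMorphism.Build _ _ pull pull_is_additive.
HB.instance Definition _ :=
  GRing.isMonoidMorphism.Build _ _ pull pull_is_multiplicative.

Lemma Dv_pull v a : Dv v (pull a) = \sum_i Dv v (t i) * pull (Dv (b i) a).
Proof.
apply: ev_inj => x; rewrite inE => Ux.
rewrite (@ev_Dv_eq _ _ _ _ _ _ (ev a \o T)) //; last first.
  by move=> y; rewrite inE => Uy; rewrite ev_pull.
rewrite (derive_comp_comb oU TU TE st (ev_smooth a)) // ev_sum //.
apply: eq_bigr => i _; rewrite evM // ev_Dv // ev_pull // ev_Dv //.
exact: TU.
Qed.

End Pullback.

(** * Finsler functions in a chart *)

Lemma smooth_on_linear (R : realType) (V W : normedModType R) (U : set V)
  (L : {linear V -> W}) : continuous L -> smooth_on U L.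
Proof.
move=> cL [|k]; first by move=> x _; exact: cL.
split=> [x _|v]; first exact: linear_differentiable.
have -> : 'D_v L = (fun=> L v); last exact: Ck_on_cst.
by apply/funext => x; rewrite deriveE ?diff_lin //; exact: linear_differentiable.
Qed.

Section Coordinates.
Variables (R : realType) (n : nat).
Local Notation V := 'rV[R]_n.

Definition coord_vec (s : 'I_n + 'I_n) : V * V :=
  match s with inl i => (delta_mx 0 i, 0) | inr i => (0, delta_mx 0 i) end.

Definition coord (s : 'I_n + 'I_n) (z : V * V) : R :=
  match s with inl i => z.1 0 i | inr i => z.2 0 i end.

Definition rcoord (i : 'I_n) (v : V) : R := v 0 i.

Lemma rcoord_is_linear i : linear (rcoord i).
Proof. by move=> k u v; rewrite /rcoord !mxE. Qed.
HB.instance Definition _ i :=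
  GRing.isLinear.Build R V R _ (rcoord i) (rcoord_is_linear i).

Lemma rcoord_cont i : continuous (rcoord i).
Proof. exact: coord_continuous. Qed.

Lemma coord_is_linear s : linear (coord s).
Proof. by case: s => i k u v; rewrite /= !mxE. Qed.
HB.instance Definition _ s :=
  GRing.isLinear.Build R (V * V)%type R _ (coord s) (coord_is_linear s).

Lemma coord_cont s : continuous (coord s).
Proof.
case: s => i z.
  apply: (@continuous_comp _ _ _ fst (fun x : V => x 0 i)); first exact: cvg_fst.
  exact: coord_continuous.
apply: (@continuous_comp _ _ _ snd (fun x : V => x 0 i)); first exact: cvg_snd.
exact: coord_continuous.
Qed.

Lemma coord_vec_decomp (z : V * V) : z = \sum_s coord s z *: coord_vec s.
Proof.
rewrite big_sumType /=; case: z => x y /=.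
have e (v : V) : v = \sum_i v 0 i *: delta_mx 0 i by exact: row_sum_delta.
have s1 (F : 'I_n -> V * V) : (\sum_i F i).1 = \sum_i (F i).1.
  exact: (big_morph fst (fun _ _ => erefl) erefl).
have s2 (F : 'I_n -> V * V) : (\sum_i F i).2 = \sum_i (F i).2.
  exact: (big_morph snd (fun _ _ => erefl) erefl).
apply: injective_projections; rewrite /= ?s1 ?s2 /=.
  by rewrite [X in _ + X]big1 ?addr0 -?e // => i _; rewrite scaler0.
by rewrite [X in X + _]big1 ?add0r -?e // => i _; rewrite scaler0.
Qed.

Lemma derive_decomp (f : V * V -> R) z v : differentiable f z ->
  'D_v f z = \sum_i v.1 0 i * ddx i f z + \sum_i v.2 0 i * ddy i f z.
Proof.
move=> df; rewrite (deriveE _ df) {1}(coord_vec_decomp v) linear_sum big_sumType /=.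
by congr (_ + _); apply: eq_bigr => i _; rewrite linearZ /ddx /ddy deriveE.
Qed.

End Coordinates.

Section Local.
Variables (R : realType) (n : nat) (M : smoothManifold R n).
Local Notation V := 'rV[R]_n.
Variables (F : tangentBundle M -> R) (F_finsler : isFinsler F)
  (S : vectorFieldT0 M) (S_spray : isGeodesicSpray F S).
Variables (a : Defs.index M) (U : set (V * V)) (oU : open U) (sU : U `<=` T0_dom a).

Local Notation A := (smoothFct oU).
(** U is any open part of the slit chart, so that the same results serve on whole charts and on
    overlaps. *)
Definition dx (i : 'I_n) : A -> A := Dv (coord_vec R (inl i)).
Definition dy (i : 'I_n) : A -> A := Dv (coord_vec R (inr i)).
Definition fibre_coord (i : 'I_n) : A :=
  smooth_restr oU (@smooth_on_linear _ _ _ U (coord (inr i)) (@coord_cont R n (inr i))).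

Definition finsler_fct : A :=
  smooth_restr oU (smooth_on_sub sU (finsler_smooth F_finsler a)).
Definition energy : A := finsler_fct * finsler_fct.

Lemma sprayG_smooth i : smooth_on U (sprayG S a i).
Proof.
have -> : sprayG S a i = (fun r => (- 2^-1) *: r) \o (coord (inr i) \o S a).
  by apply/funext => z; rewrite /sprayG /= scaleNr.
apply: smooth_on_linear_comp => //; first exact: scaler_continuous.
apply: smooth_on_linear_comp => //; first exact: coord_cont.
exact/(smooth_on_sub sU)/vf_smooth.
Qed.

Definition spray_coef i : A := smooth_restr oU (sprayG_smooth i).

Lemma derivation_dx i : derivation (dx i). Proof. exact: derivation_Dv. Qed.
Lemma derivation_dy i : derivation (dy i). Proof. exact: derivation_Dv. Qed.
Lemma dxdx i j f : dx i (dx j f) = dx j (dx i f). Proof. exact: Dv_comm. Qed.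
Lemma dydx i j f : dy i (dx j f) = dx j (dy i f). Proof. exact: Dv_comm. Qed.
Lemma dydy i j f : dy i (dy j f) = dy j (dy i f). Proof. exact: Dv_comm. Qed.

Lemma ev_Dv_fibre_coord v i z : U z -> ev (Dv v (fibre_coord i)) z = v.2 0 i.
Proof.
move=> Uz; rewrite (@ev_Dv_eq _ _ _ _ _ _ (coord (inr i))) //; last first.
  by move=> w; rewrite inE => Uw; rewrite ev_smooth_restr.
rewrite deriveE; last exact/linear_differentiable/coord_cont.
by rewrite diff_lin //; exact: coord_cont.
Qed.

Lemma dx_fibre_coord i j : dx i (fibre_coord j) = 0.
Proof.
by apply: ev_inj => z; rewrite inE => Uz; rewrite ev_Dv_fibre_coord //= mxE ev0.
Qed.

Lemma dy_fibre_coord i j : dy i (fibre_coord j) = (i == j)%:R.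
Proof.
apply: ev_inj => z; rewrite inE => Uz; rewrite ev_Dv_fibre_coord //= mxE eqxx /= ev_nat //.
by rewrite eq_sym.
Qed.

Lemma ev_fibre_coord i z : U z -> ev (fibre_coord i) z = z.2 0 i.
Proof. exact: ev_smooth_restr. Qed.

Lemma ev_energy z : U z -> ev energy z = Defs.repr F a z ^+ 2.
Proof. by move=> Uz; rewrite evM // ev_smooth_restr. Qed.

Lemma dy_energy j : dy j energy = 2 * (finsler_fct * dy j finsler_fct).
Proof. by rewrite /energy (derivationM (derivation_dy j)); ring. Qed.

Lemma ev_finsler_fct z : U z -> ev finsler_fct z = Defs.repr F a z.
Proof. exact: ev_smooth_restr. Qed.

Lemma ev_dy_finsler_fct j z : U z -> ev (dy j finsler_fct) z = dJ (Defs.repr F a) j z.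
Proof. by move=> Uz; apply: ev_Dv_eq => // w; rewrite inE; exact: ev_finsler_fct. Qed.

Lemma ev_spray_coef i z : U z -> ev (spray_coef i) z = sprayG S a i z.
Proof. exact: ev_smooth_restr. Qed.

Lemma ev_dx i f g z : U z -> {in U, ev f =1 g} -> ev (dx i f) z = ddx i g z.
Proof. exact: ev_Dv_eq. Qed.

Lemma ev_dy i f g z : U z -> {in U, ev f =1 g} -> ev (dy i f) z = ddy i g z.
Proof. exact: ev_Dv_eq. Qed.

Lemma ev_derive f v z : U z -> 'D_v (ev f) z =
  \sum_i v.1 0 i * ev (dx i f) z + \sum_i v.2 0 i * ev (dy i f) z.
Proof.
move=> Uz; rewrite derive_decomp; last exact: ev_differentiable.
by congr (_ + _); apply: eq_bigr => i _; rewrite (@ev_Dv _ _ _ oU _ f).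
Qed.

Local Notation spray' := (spray dx dy fibre_coord spray_coef).
Local Notation hor' := (hor dx dy spray_coef).
Local Notation N' := (nonlin dy spray_coef).

Lemma ev_spray f z : U z -> ev (spray' f) z = 'D_(S a z) (ev f) z.
Proof.
move=> Uz; rewrite ev_derive // (spray_dx S_spray (sU Uz)) evB // !ev_sum //.
rewrite -sumrN; congr (_ + _); apply: eq_bigr => i _.
  by rewrite evM // ev_fibre_coord.
rewrite !evM // ev_spray_coef // ev_nat // /sprayG -mulNr; congr (_ * _).
by rewrite mulrN opprK mulrA divff ?mul1r // pnatr_eq0.
Qed.

Lemma ev_liouville f z : U z -> ev (liouville dy fibre_coord f) z = 'D_(0, z.2) (ev f) z.
Proof.
move=> Uz; rewrite ev_derive //= [X in X + _]big1 ?add0r => [|i _].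
  by rewrite ev_sum //; apply: eq_bigr => i _; rewrite evM // ev_fibre_coord.
by rewrite mxE mul0r.
Qed.

(** Euler's relation: F(x, (1 + s) y) = (1 + s) F(x, y) is differentiated at s = 0, with s so small
    that 1 + s > 0 and the point stays in U. *)
Lemma liouville_finsler_fct : liouville dy fibre_coord finsler_fct = finsler_fct.
Proof.
apply: ev_inj => z; rewrite inE => Uz; rewrite ev_liouville //.
have [Uz1 z2] := sU Uz; pose v : V * V := (0, z.2).
have dF : differentiable (ev finsler_fct) (z + (0 : R) *: v).
  by rewrite scale0r addr0; exact: ev_differentiable.
have [_] := is_derive_line dF; rewrite scale0r addr0 => <-.
pose c := ev finsler_fct z.
have cE : c = Defs.repr F a z by exact: ev_smooth_restr.
have -> : 'D_1 (fun s : R => ev finsler_fct (z + s *: v)) 0 =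
    'D_1 (fun s : R => (1 + s) * c) 0.
  apply: near_eq_derive.
  have n1 : \forall s \near (0 : R), -1 < s by apply: lt_nbhsr; rewrite ltrN10.
  have nU : \forall s \near (0 : R), U (z + s *: v).
    have : nbhs (z + (0 : R) *: v) U by rewrite scale0r addr0; exact: (near_open oU Uz).
    apply: (@continuousD _ _ _ (fun=> z) (fun s : R => s *: v)).
      exact: cvg_cst.
    exact: scalel_continuous.
  move: n1 nU; apply: filterS2 => s s1 Us; rewrite ev_smooth_restr // cE.
  have -> : z + s *: v = (z.1, (1 + s) *: z.2).
    rewrite /v; apply: injective_projections => /=.
      by rewrite scaler0 addr0.
    by rewrite scalerDl scale1r.
  by rewrite (finsler_homogeneous F_finsler) // addrC -ltrBlDr sub0r.
have -> : (fun s : R => (1 + s) * c) = (cst c + (c \*: id)).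
  by apply/funext => s /=; rewrite /= !fctE /= mulrDl mul1r mulrC.
rewrite deriveD; [|exact: derivable_cst|exact: derivableZ].
by rewrite derive_cst add0r deriveZ // derive_id [_ *: _]mulr1.
Qed.

Lemma liouville_energy : liouville dy fibre_coord energy = 2 * energy.
Proof.
rewrite (derivationM (derivation_liouville fibre_coord derivation_dy)).
by rewrite liouville_finsler_fct /energy; ring.
Qed.

(** The spray equation is evaluated on Y = d/dx^j. Its two terms are S(E_j) and y^i dE_i/dx^j, and
    the latter is 2 dE/dx^j by homogeneity. *)
Lemma spray_dy_energy j : spray' (dy j energy) = dx j energy.
Proof.
apply: ev_inj => z; rewrite inE => Uz.
have EEe : {in U, ev energy =1 fun w => Defs.repr F a w ^+ 2}.
  by move=> w; rewrite inE; exact: ev_energy.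
have dE w : U w -> differentiable (fun w => Defs.repr F a w ^+ 2) w.
  move=> Uw; apply: near_eq_differentiable (ev_differentiable energy Uw).
  by apply: filterS (near_open oU Uw) => x; exact: ev_energy.
have := spray_eq S_spray (sU Uz) (coord_vec R (inl j)).
rewrite -(deriveE _ (dE z Uz)) -(ev_Dv_eq _ Uz EEe) -[Dv _ energy]/(dx j energy).
rewrite /ext_d.
(* In [ext_d] the vector [v] is frozen, so its components are constants for the derivative along
   [X]. *)
have h (X v : V * V) : 'D_X (fun w => dJ_form (fun w => Defs.repr F a w ^+ 2) w v) z =
    \sum_i v.1 0 i * 'D_X (ev (dy i energy)) z.
  have e : {in U, ev (\sum_i smooth_cst oU (v.1 0 i) * dy i energy) =1
      fun w => dJ_form (fun w => Defs.repr F a w ^+ 2) w v}.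
    move=> w; rewrite inE => Uw; rewrite /dJ_form -(deriveE _ (dE w Uw)).
    rewrite -(derive_eq_on _ oU EEe Uw) ev_derive //= [X in _ = X + _]big1 ?add0r.
      by rewrite ev_sum //; apply: eq_bigr => i _; rewrite evM // ev_smooth_cst.
    by move=> i _; rewrite mxE mul0r.
  rewrite -(ev_Dv_eq X Uz e) (derivation_sum (derivation_Dv oU X)) ev_sum //.
  apply: eq_bigr => i _; rewrite (derivationM (derivation_Dv oU X)) Dv_smooth_cst.
  by rewrite mul0r add0r evM // ev_smooth_cst // ev_Dv.
have h1 : \sum_i (coord_vec R (inl j)).1 0 i * 'D_(S a z) (ev (dy i energy)) z =
    ev (spray' (dy j energy)) z.
  rewrite ev_spray // (bigD1 j) //= big1 ?addr0 => [|i ij].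
    by rewrite mxE !eqxx mul1r.
  by rewrite mxE (negbTE ij) andbF mul0r.
have h2 : \sum_i (S a z).1 0 i * 'D_(coord_vec R (inl j)) (ev (dy i energy)) z =
    2 * ev (dx j energy) z.
  rewrite (spray_dx S_spray (sU Uz)).
  rewrite -(ev_nat oU 2 Uz) -evM // -(derivationMnl (derivation_dx j)) -liouville_energy.
  rewrite (P_liouville derivation_dx dydx dx_fibre_coord) ev_sum //.
  by apply: eq_bigr => i _; rewrite evM // ev_fibre_coord // dydx ev_Dv.
rewrite h h1 h h2; move: (ev _ z) (ev _ z) => q p /eqP.
by rewrite subr_eq => /eqP ->; ring.
Qed.

Lemma energy_nondeg (c : 'I_n -> A) :
  (forall k, \sum_i c i * dy i (dy k energy) = 0) -> forall i, c i = 0.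
Proof.
move=> h i; apply: ev_inj => z; rewrite inE => Uz; rewrite ev0 //.
pose v : V := \row_j ev (c j) z.
have EEe : {in U, ev energy =1 fun w => Defs.repr F a w ^+ 2}.
  by move=> w; rewrite inE; exact: ev_energy.
have v0 : v *m metric F a z = 0.
  apply/rowP => k; rewrite !mxE; apply/eqP.
  have /(congr1 (fun f => 2^-1 * ev f z)) := h k; rewrite ev0 // mulr0.
  rewrite ev_sum // mulr_sumr.
  move=> /eqP; congr (_ == _); apply: eq_bigr => j _; rewrite !mxE evM // mulrCA.
  congr (_ * (_ * _)); apply: ev_dy => // w; rewrite inE => Uw.
  exact: ev_dy.
have rf : row_free (metric F a z).
  by rewrite -row_leq_rank (finsler_rank F_finsler (sU Uz)).
have : v = 0 by apply: (row_free_inj rf); rewrite v0 mul0mx.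
by move/rowP/(_ i); rewrite !mxE.
Qed.

Lemma energy_gt0 z : U z -> 0 < ev energy z.
Proof.
by move=> Uz; rewrite ev_energy // exprn_gt0 // (finsler_gt0 F_finsler (sU Uz)).
Qed.

Lemma energy_reg (x : A) : energy * x = 0 -> x = 0.
Proof.
move=> Ex; apply: ev_inj => z; rewrite inE => Uz.
have /(congr1 (fun f => ev f z)) := Ex; rewrite evM // ev0 // => /eqP.
by rewrite mulf_eq0 gt_eqF ?energy_gt0 //= => /eqP.
Qed.

Lemma ev_nonlin i j z : U z -> ev (N' i j) z = sprayN S a i j z.
Proof. by move=> Uz; apply: ev_dy => // w; rewrite inE; exact: ev_spray_coef. Qed.

Lemma ev_hor i f g z : U z -> {in U, ev f =1 g} -> ev (hor' i f) z = deltax S a i g z.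
Proof.
move=> Uz fg; rewrite evB // ev_sum // (ev_dx _ Uz fg); congr (_ - _).
by apply: eq_bigr => j _; rewrite evM // ev_nonlin // (ev_dy _ Uz fg).
Qed.

Lemma ev_curv k i j z : U z ->
  ev (curv dx dy spray_coef k i j) z = curvature S a k i j z.
Proof.
move=> Uz; rewrite evB //; congr (_ - _); apply: ev_hor => // w; rewrite inE;
  exact: ev_nonlin.
Qed.

Lemma ev_jacobi i j z : U z ->
  ev (jacobi dx dy fibre_coord spray_coef i j) z = Jacobi S a z i j.
Proof.
move=> Uz; rewrite mxE evD // evB // evM // ev_nat // ev_sum //.
rewrite (@ev_hor _ _ (sprayG S a i)) //; last first.
  by move=> w; rewrite inE; exact: ev_spray_coef.
rewrite ev_spray //; congr (_ - _ + _).
  by apply: derive_eq_on oU _ Uz => w; rewrite inE; exact: ev_nonlin.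
by apply: eq_bigr => k _; rewrite evM // !ev_nonlin.
Qed.

Local Notation tr := (trjacobi dx dy fibre_coord spray_coef).

Lemma ev_trjacobi z : U z -> ev tr z = \tr (Jacobi S a z).
Proof. by move=> Uz; rewrite ev_sum //; apply: eq_bigr => i _; rewrite ev_jacobi. Qed.

Lemma ev_dy_trjacobi i z : U z -> ev (dy i tr) z = dJ (fun w => \tr (Jacobi S a w)) i z.
Proof. by move=> Uz; apply: ev_dy => // w; rewrite inE; exact: ev_trjacobi. Qed.

Hypothesis n_ge3 : (3 <= n)%N.

(** Passage from the pointwise condition to the ring identity, multiplying by 2 (n - 1), which is
    nonzero. *)
Lemma W1_isotropic : (forall z, U z -> forall k i j, W1 S a k i j z = 0) <->
  (forall k i j, (2 * (n%:R - 1)) * curv dx dy spray_coef k i j =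
    dy i tr * (k == j)%:R - dy j tr * (k == i)%:R).
Proof.
have c0 : (2 * (n%:R - 1) : R) != 0.
  by rewrite mulf_eq0 pnatr_eq0 /= subr_eq0 (eqr_nat R n 1); case: n n_ge3 => [|[]].
have e z : U z -> forall k i j, (W1 S a k i j z == 0) =
    (ev ((2 * (n%:R - 1)) * curv dx dy spray_coef k i j) z ==
     ev (dy i tr * (k == j)%:R - dy j tr * (k == i)%:R) z).
  move=> Uz k i j; rewrite evM // evM // evB // !ev_nat // ev1 // ev_curv //.
  rewrite evB // !evM // !ev_nat // !ev_dy_trjacobi // /W1 subr_eq0 -/(wedgeJ _ k i j z).
  by rewrite -(inj_eq (mulfI c0)) mulVKf.
split=> [W0 k i j|iso z Uz k i j].
  by apply: ev_inj => z; rewrite inE => Uz; apply/eqP; rewrite -e // W0.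
by apply/eqP; rewrite e // iso.
Qed.

Hypothesis W0 : forall z, U z -> forall k i j, W1 S a k i j z = 0.
Let iso := W1_isotropic.1 W0.

Lemma energy_dy_trjacobi i : energy * dy i tr = tr * dy i energy.
Proof.
exact: (E_Qtrjacobi derivation_dx derivation_dy dxdx dydx dydy
  dx_fibre_coord dy_fibre_coord liouville_energy spray_dy_energy
  (@smoothFct_natreg _ _ _ oU) energy_nondeg iso).
Qed.

Lemma energy_dx_trjacobi i : energy * dx i tr = tr * dx i energy.
Proof.
exact: (E_Ptrjacobi derivation_dx derivation_dy dxdx dydx dydy
  dx_fibre_coord dy_fibre_coord liouville_energy spray_dy_energy
  energy_reg (@smoothFct_natreg _ _ _ oU) energy_nondeg n_ge3 iso).
Qed.

Lemma energy_jacobi i j :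
  2 * (n%:R - 1) * energy * jacobi dx dy fibre_coord spray_coef i j =
    tr * (2 * energy * (i == j)%:R - dy j energy * fibre_coord i).
Proof.
exact: (jacobi_isotropic derivation_dx derivation_dy dxdx dydx dydy
  dx_fibre_coord dy_fibre_coord liouville_energy spray_dy_energy
  (@smoothFct_natreg _ _ _ oU) energy_nondeg iso).
Qed.

End Local.

(** * Changes of charts and the flag curvature function *)

Section Charts.
Variables (R : realType) (n : nat) (M : smoothManifold R n).
Local Notation V := 'rV[R]_n.
Implicit Types (a b : Defs.index M).

Lemma open_slit (O : set V) : open O -> open [set z : V * V | O z.1 /\ z.2 != 0].
Proof.
move=> oO; have -> : [set z : V * V | O z.1 /\ z.2 != 0] =
    (fst @^-1` O) `&` (snd @^-1` [set y : V | y != 0]) by [].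
apply: openI; apply: open_comp => //.
- by move=> z _; exact: cvg_fst.
- by move=> z _; exact: cvg_snd.
have -> : [set y : V | y != 0] = ~` [set 0].
  by apply/seteqP; split => y /=; [move=> /eqP|move=> /eqP].
apply: closed_openC.
exact: accessible_closed_set1 (hausdorff_accessible (@norm_hausdorff _ _)) _.
Qed.

Lemma T0_dom_open a : open (T0_dom a : set (V * V)).
Proof. exact/open_slit/chart_im_open. Qed.

Definition overlap a b : set V := [set x | chart_im a x /\ chart_dom b (chart_inv a x)].

Lemma overlap_open a b : open (overlap a b).
Proof.
rewrite openE => x [ax bx]; apply: filterI.
  by apply: open_nbhs_nbhs; split=> //; exact: chart_im_open.
apply: (@chart_inv_continuous _ _ M a x ax).
by apply: open_nbhs_nbhs; split=> //; exact: chart_dom_open.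
Qed.

Definition T0_overlap a b : set (V * V) := [set z | overlap a b z.1 /\ z.2 != 0].

Lemma T0_overlap_open a b : open (T0_overlap a b).
Proof. exact/open_slit/overlap_open. Qed.

Lemma trans_differentiable_overlap a b x : overlap a b x -> differentiable (trans a b) x.
Proof. by move=> abx; have [df _] := @trans_smooth _ _ M a b 1%N; exact: df. Qed.

Lemma diff_trans_id a x y : chart_im a x -> 'd (trans a a) x y = y.
Proof.
move=> ax; have ov : overlap a a x by split=> //; exact: chart_inv_sub.
rewrite -(deriveE _ (trans_differentiable_overlap ov)) -[RHS](derive_id x y).
apply: near_eq_derive.
apply: filterS (near_open (@chart_im_open _ _ M a) ax) => w aw.
by rewrite /trans /= chart_invK.
Qed.

(** By the cocycle identity, the differential of the reverse change of charts is a left inverse. *)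
Lemma diff_trans_inj a b x y : overlap a b x -> 'd (trans a b) x y = 0 -> y = 0.
Proof.
move=> [ax bx] dy0; have pa := chart_inv_sub ax.
apply: (etrans (esym (diff_trans_id y ax))).
have := diff_trans y pa bx pa; rewrite (chart_invK ax).
move=> e; apply: (etrans e); apply: (etrans (congr1 _ dy0)); exact: linear0.
Qed.

Lemma tangentBundle_eq (u v : tangentBundle M) :
  Defs.base u = Defs.base v -> Defs.comp u =1 Defs.comp v -> u = v.
Proof.
case: u v => [p c ct co] [q d dt ou] /= pq /funext cd; subst q d.
by congr TangentBundle; exact: Prop_irrelevance.
Qed.

(** Both sides have the same base point; their components agree by the cocycle identity in charts
    around it and are 0 in the others. *)
Lemma tangent_of_trans a b x y : overlap a b x ->
  tangent_of b (trans a b x) ('d (trans a b) x y) = tangent_of a x y.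
Proof.
move=> [ax bx]; have pE : chart_inv b (trans a b x) = chart_inv a x.
  by rewrite /trans /= chartK.
apply: tangentBundle_eq => //= c; rewrite /tangent_comp pE.
case: pselect => [[pb pc]|nbc]; case: pselect => [[pa pc']|nac] //.
- by have := diff_trans y pa pb pc; rewrite (chart_invK ax) => e; exact: esym e.
- by case: nac; split=> //; exact: chart_inv_sub.
- by case: nbc.
Qed.

Lemma T_trans_T0 a b z : T0_overlap a b z -> T0_dom b (T_trans a b z).
Proof.
move=> [abz z2]; split=> /=; first by apply: chart_sub; case: abz.
by apply: contra z2 => /eqP dy0; apply/eqP/(diff_trans_inj abz dy0).
Qed.

Definition kappa (F : tangentBundle M -> R) (S : vectorFieldT0 M) (c : Defs.index M)
    (z : V * V) : R :=
  \tr (Jacobi S c z) / ((n%:R - 1) * Defs.repr F c z ^+ 2).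

Section Change.
Variables (a b : Defs.index M).
Local Notation oU := (T0_overlap_open (a := a) (b := b)).
Local Notation oU' := (T0_dom_open (a := b)).
Local Notation A := (smoothFct oU).

Lemma trans_coord_smooth k : smooth_on (T0_overlap a b) ((rcoord k \o trans a b) \o fst).
Proof.
apply: (@smooth_on_sub _ _ _ (fst @^-1` overlap a b)); first by move=> z [].
apply: (@smooth_on_comp_linear _ _ _ _ fst); first by move=> z; exact: cvg_fst.
apply: smooth_on_linear_comp.
- exact: rcoord_cont.
- exact: overlap_open.
- exact: trans_smooth.
Qed.

Definition trans_coord k : A := smooth_restr oU (trans_coord_smooth k).

Lemma ev_Dv_trans_coord v k z : T0_overlap a b z ->
  ev (Dv v (trans_coord k)) z = 'd (trans a b) (z.1) v.1 0 k.
Proof.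
move=> Uz; rewrite (@ev_Dv_eq _ _ _ _ _ _ ((rcoord k \o trans a b) \o fst)) //; last first.
  by move=> w; rewrite inE => Uw; rewrite ev_smooth_restr.
have dt : differentiable (trans a b) z.1.
  by apply: trans_differentiable_overlap; case: Uz.
rewrite derive_comp_linear derive_linear_comp //; last exact: rcoord_cont.
by rewrite deriveE.
Qed.

Definition jac k i : A := dx i (trans_coord k).
Definition trans_fibre k : A := \sum_i jac k i * fibre_coord oU i.

Lemma dy_trans_coord i k : dy i (trans_coord k) = 0.
Proof.
apply: ev_inj => z; rewrite inE => Uz; rewrite ev_Dv_trans_coord //= ev0 //.
by rewrite linear0 mxE.
Qed.

Lemma ev_trans_fibre k z : T0_overlap a b z -> ev (trans_fibre k) z = (T_trans a b z).2 0 k.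
Proof.
move=> Uz; rewrite ev_sum //= (row_sum_delta z.2) linear_sum summxE.
apply: eq_bigr => i _; rewrite evM // ev_fibre_coord // ev_Dv_trans_coord //= linearZ mxE.
by rewrite mulrC.
Qed.

Definition T_trans_comp (s : 'I_n + 'I_n) : A :=
  match s with inl k => trans_coord k | inr k => trans_fibre k end.

Lemma T_trans_coord z : T0_overlap a b z ->
  T_trans a b z = \sum_s ev (T_trans_comp s) z *: coord_vec R s.
Proof.
move=> Uz; rewrite [LHS]coord_vec_decomp; apply: eq_bigr => s _; congr (_ *: _).
case: s => k /=; first by rewrite ev_smooth_restr.
by rewrite ev_trans_fibre.
Qed.

Local Notation pl := (@pull _ _ _ _ oU _ oU' _ (@T_trans_T0 a b) _ _ _ T_trans_coord).

Lemma pull_fibre_coord k : pl (fibre_coord oU' k) = trans_fibre k.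
Proof.
apply: ev_inj => z; rewrite inE => Uz.
by rewrite ev_pull // ev_fibre_coord ?ev_trans_fibre //; exact: T_trans_T0.
Qed.

Lemma dy_jac i j k : dy i (jac k j) = 0.
Proof. by rewrite /jac dydx dy_trans_coord (derivation0 (derivation_dx _ _)). Qed.

Lemma dy_trans_fibre i k : dy i (trans_fibre k) = jac k i.
Proof.
rewrite /trans_fibre (derivation_sum (derivation_dy _ _)) -[RHS](sum_delta (jac k)).
apply: eq_bigr => j _; rewrite (derivationM (derivation_dy _ _)) dy_jac mul0r add0r.
by rewrite dy_fibre_coord.
Qed.

Lemma dx_jac i j k : dx i (jac k j) = dx j (jac k i).
Proof. exact: dxdx. Qed.

Lemma dy_pull i f : dy i (pl f) = \sum_k jac k i * pl (dy k f).
Proof.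
rewrite /dy Dv_pull big_sumType /= big1 ?add0r => [|k _]; last first.
  by rewrite -/(dy i (trans_coord k)) dy_trans_coord mul0r.
by apply: eq_bigr => k _; rewrite -/(dy i (trans_fibre k)) dy_trans_fibre.
Qed.

Lemma dx_pull i f : dx i (pl f) =
  \sum_k jac k i * pl (dx k f) + \sum_k dx i (pl (fibre_coord oU' k)) * pl (dy k f).
Proof.
rewrite /dx Dv_pull big_sumType /=; congr (_ + _).
by apply: eq_bigr => k _; rewrite pull_fibre_coord.
Qed.

Variables (F : tangentBundle M -> R) (F_finsler : isFinsler F)
  (S : vectorFieldT0 M) (S_spray : isGeodesicSpray F S).

Lemma T0_overlap_sub : T0_overlap a b `<=` T0_dom a.
Proof. by move=> z [[]]. Qed.

Local Notation sU := T0_overlap_sub.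
Local Notation sU' := (@subset_refl _ (T0_dom b)).

Lemma pull_energy : pl (energy F_finsler oU' sU') = energy F_finsler oU sU.
Proof.
apply: ev_inj => z; rewrite inE => Uz.
rewrite ev_pull // !ev_energy //; last exact: T_trans_T0.
by rewrite /Defs.repr /T_trans /= tangent_of_trans //; case: Uz.
Qed.

(** S is one vector field on all charts: its derivative of the new fibre coordinate is its component
    in the new chart, which is -2 G'^k. *)
Lemma spray_pull_fibre_coord k :
  spray (@dx _ _ _ oU) (@dy _ _ _ oU) (fibre_coord oU) (spray_coef S oU sU)
    (pl (fibre_coord oU' k)) =
  - (2 * pl (spray_coef S oU' sU' k)).
Proof.
apply: ev_inj => z; rewrite inE => Uz; have Tz := T_trans_T0 Uz.
rewrite (ev_spray S_spray) // evN // evM // ev_nat // ev_pull // ev_spray_coef //.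
rewrite pull_fibre_coord.
have [dT DT] := comb_differentiable oU T_trans_coord
  (fun s => ev_smooth (T_trans_comp s)) Uz.
rewrite /sprayG mulrN opprK mulrA divff ?pnatr_eq0 // mul1r.
have -> : S b (T_trans a b z) = 'd (T_trans a b) z (S a z).
  by apply: vf_trans; [exact: sU|case: Uz => -[]].
rewrite -(deriveE _ dT).
have : coord (inr k) ('D_(S a z) (T_trans a b) z) =
    'D_(S a z) (coord (inr k) \o T_trans a b) z.
  by rewrite derive_linear_comp //; exact: coord_cont.
move=> /= ->; apply: derive_eq_on oU _ Uz => w; rewrite inE => Uw.
by rewrite ev_trans_fibre.
Qed.

Hypothesis n_ge3 : (3 <= n)%N.
Hypothesis W0 : W1_eq0 S.

Lemma kappa_trans z : T0_overlap a b z -> kappa F S b (T_trans a b z) = kappa F S a z.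
Proof.
move=> Uz; have Tz := T_trans_T0 Uz.
have W0a w : T0_overlap a b w -> forall k i j, W1 S a k i j w = 0.
  by move=> Uw; apply: W0; exact: sU.
have tp := trace_pull (derivation_dx oU) (derivation_dy oU) (@dxdx _ _ _ oU)
  (@dydx _ _ _ oU) (@dydy _ _ _ oU) (dx_fibre_coord oU) (dy_fibre_coord oU)
  (dx_fibre_coord oU') (dy_fibre_coord oU')
  dy_pull dx_pull pull_fibre_coord dy_jac dx_jac
  spray_pull_fibre_coord (@smoothFct_natreg _ _ _ oU)
  pull_energy (liouville_energy F_finsler oU sU)
  (@energy_dy_trjacobi _ _ _ _ F_finsler _ S_spray _ _ oU sU n_ge3 W0a)
  (@energy_dy_trjacobi _ _ _ _ F_finsler _ S_spray _ _ oU' sU' n_ge3 (W0 (a := b)))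
  ((W1_isotropic S_spray oU sU n_ge3).1 W0a)
  ((W1_isotropic S_spray oU' sU' n_ge3).1 (W0 (a := b))).
rewrite /kappa -(ev_trjacobi S_spray oU' sU') // -(ev_trjacobi S_spray oU sU) //.
rewrite -(ev_energy F_finsler oU' sU') // -(ev_energy F_finsler oU sU) //.
rewrite -pull_energy ev_pull //.
congr (_ / _); apply/eqP; rewrite eq_sym -subr_eq0; apply/negP => /negP t0.
(* If the traces differed at z, then phi'(x) would kill 2 E e_j - E_j y, whence
   2 E = E_j y^j for each j; summing over j gives n = 1. *)
have gen (E J p D d : A) : d * (2 * E * J - p * D) = 0 -> ev d z != 0 ->
    2 * ev E z * ev J z = ev p z * ev D z.
  move=> /(congr1 (fun f => ev f z)); rewrite evM // evB // !evM // ev_nat // ev0 //.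
  by move=> /eqP; rewrite mulf_eq0 subr_eq0 => /orP[->|/eqP].
have e k j : 2 * ev (energy F_finsler oU sU) z * ev (jac k j) z =
    ev (trans_fibre k) z * ev (dy j (energy F_finsler oU sU)) z.
  by rewrite -pull_fibre_coord; apply: gen (tp k j) _; rewrite evB // ev_pull.
pose E := ev (energy F_finsler oU sU) z; rewrite -/E in e.
have c j : 2 * E = ev (dy j (energy F_finsler oU sU)) z * z.2 0 j.
  pose w : V := (2 * E) *: delta_mx 0 j - ev (dy j (energy F_finsler oU sU)) z *: z.2.
  have /(diff_trans_inj Uz.1) : 'd (trans a b) (z.1) w = 0.
    apply/rowP => k; rewrite linearB !linearZ !mxE.
    have e1 : 'd (trans a b) (z.1) (delta_mx 0 j) 0 k = ev (jac k j) z.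
      by rewrite ev_Dv_trans_coord.
    have e2 : 'd (trans a b) (z.1) z.2 0 k = ev (trans_fibre k) z by rewrite ev_trans_fibre.
    apply: (etrans (congr2 (fun p q => 2 * E * p + _ * - q) e1 e2)).
    by rewrite mulrN e mulrC subrr.
  by move/rowP/(_ j); rewrite !mxE !eqxx mulr1 => /eqP; rewrite subr_eq0 => /eqP.
have E0 : 0 < E by exact: energy_gt0.
have : \sum_(j < n) (2 * E) = 2 * E.
  transitivity (\sum_j ev (dy j (energy F_finsler oU sU)) z * z.2 0 j).
    by apply: eq_bigr => j _; exact: c.
  have /(congr1 (fun f => ev f z)) := liouville_energy F_finsler oU sU.
  rewrite [ev (2 * _) z]evM // ev_nat // -/E => <-; rewrite ev_sum //.
  by apply: eq_bigr => j _; rewrite evM // ev_fibre_coord // mulrC.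
rewrite sumr_const card_ord => h.
have /eqP : (n%:R - 1) * (2 * E) = 0
  by rewrite mulrBl mul1r (mulr_natl (2 * E) n) h subrr.
rewrite !mulf_eq0 pnatr_eq0 (gt_eqF E0) !orbF.
by rewrite subr_eq0 (eqr_nat R n 1); case: n n_ge3 => [|[]].
Qed.

End Change.

(** * From local to global constancy of the flag curvature *)

Section Constancy.
Variables (F : tangentBundle M -> R) (F_finsler : isFinsler F)
  (S : vectorFieldT0 M) (S_spray : isGeodesicSpray F S).
Hypotheses (n_ge3 : (3 <= n)%N) (W0 : W1_eq0 S).
Local Notation kappa := (kappa F S).

(** Every directional derivative is a combination of coordinate ones, so E D_v t = t D_v E, and the
    quotient rule applies. *)
Lemma ratio_derive (U : set (V * V)) (oU : open U) (t E : smoothFct oU) z : U z ->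
  ev E z != 0 -> (forall i, E * dx i t = t * dx i E) ->
  (forall i, E * dy i t = t * dy i E) ->
  differentiable (fun w => ev t w / ev E w) z /\
  forall v, 'D_v (fun w => ev t w / ev E w) z = 0.
Proof.
move=> Uz E0 Ex Ey.
have dE := ev_differentiable E Uz; have dt := ev_differentiable t Uz.
have dV := differentiableV dE E0.
split=> [|v]; first exact: differentiableM.
have l (f D : smoothFct oU) (r : R) : E * D = t * f ->
    ev E z * (r * ev D z) = ev t z * (r * ev f z).
  by move=> h; rewrite mulrCA -evM // h evM // mulrCA.
have DEt : ev E z * 'D_v (ev t) z = ev t z * 'D_v (ev E) z.
  have s (x y : R) (p q p' q' : 'I_n -> R) :
      (forall i, x * p i = y * p' i) -> (forall i, x * q i = y * q' i) ->
      x * (\sum_i p i + \sum_i q i) = y * (\sum_i p' i + \sum_i q' i).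
    by move=> hp hq; rewrite !mulrDr !mulr_sumr; congr (_ + _); apply: eq_bigr.
  apply: (etrans (congr1 _ (ev_derive t v Uz))).
  apply: (etrans _ (congr1 _ (esym (ev_derive E v Uz)))).
  by apply: s => i; apply: l.
rewrite (deriveM (diff_derivable dt) (diff_derivable dV)).
rewrite (deriveV E0 (diff_derivable dE)).
transitivity (ev E z ^- 2 * (ev E z * 'D_v (ev t) z - ev t z * 'D_v (ev E) z)).
  by rewrite /GRing.scale /=; field.
by rewrite DEt subrr mulr0.
Qed.

Lemma kappa_derive c z : T0_dom c z ->
  differentiable (kappa c) z /\ forall v, 'D_v (kappa c) z = 0.
Proof.
move=> Uz; pose oU := @T0_dom_open c; pose sU := @subset_refl _ (T0_dom c).
have [dg Dg] := ratio_derive Uz (lt0r_neq0 (energy_gt0 F_finsler oU sU Uz))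
  (energy_dx_trjacobi F_finsler S_spray oU sU n_ge3 (W0 (a := c)))
  (energy_dy_trjacobi F_finsler S_spray oU sU n_ge3 (W0 (a := c))).
move: dg Dg; set g := fun w => _ => dg Dg.
have kg : \near z, (n%:R - 1)^-1 *: g z = kappa c z.
  apply: filterS (near_open oU Uz) => w Uw.
  rewrite /g /kappa (ev_trjacobi S_spray) // (ev_energy F_finsler) //.
  by rewrite (invfM (n%:R - 1)); exact: mulrCA.
split=> [|v].
  apply: near_eq_differentiable kg _; exact: differentiableZ.
rewrite -(near_eq_derive _ kg) deriveZ ?Dg ?scaler0 //; exact: diff_derivable.
Qed.

Lemma kappa_segment c p w :
  (forall r : R, 0 <= r <= 1 -> T0_dom c (p + r *: w)) -> kappa c (p + w) = kappa c p.
Proof.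
move=> Hp; have [r /Hp /kappa_derive [d0]|r r01] := @mvt_line _ _ (kappa c) p w 1 ltr01.
  by [].
rewrite scale1r (kappa_derive (Hp r r01)).2 mulr0 => /eqP.
by rewrite subr_eq0 => /eqP.
Qed.

Lemma kappa_noncollinear c x y v : chart_im c x -> y != 0 ->
  (forall k : R, v != k *: y) -> kappa c (x, v) = kappa c (x, y).
Proof.
move=> cx y0 vy.
have -> : (x, v) = (x, y) + (0, v - y) :> V * V.
  by apply: injective_projections; rewrite /= ?addr0 // addrC subrK.
apply: kappa_segment => r r01; split; first by rewrite /= scaler0 addr0.
apply/eqP => /= e; have [r0|r0] := eqVneq r 0.
  by move: e y0; rewrite r0 scale0r addr0 => ->; rewrite eqxx.
have /eqP := vy (1 - r^-1); apply.
(* A zero of the segment at r distinct from 0 would force v = (1 - 1/r) y. *)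
have : r^-1 *: (y + r *: (v - y)) = 0 by rewrite e scaler0.
rewrite scalerDr scalerA mulVf // scale1r addrCA => /eqP.
by rewrite addr_eq0 => /eqP ->; rewrite opprB scalerBl scale1r.
Qed.

(** A segment between collinear vectors may cross 0, so these are joined through a third direction,
    available in dimension above 1. *)
Lemma kappa_fiber c x y v : chart_im c x -> y != 0 -> v != 0 ->
  kappa c (x, v) = kappa c (x, y).
Proof.
move=> cx y0 v0.
have [[k vk]|nk] := pselect (exists k : R, v = k *: y); last first.
  by apply: kappa_noncollinear => // k; apply/eqP => vk; apply: nk; exists k.
have [w wy] : exists w : V, forall k : R, w != k *: y.
  have [i yi] : exists i, y 0 i != 0.
    apply/existsP; apply: contraR y0; rewrite negb_exists => /forallP y0.
    by apply/eqP/rowP => i; rewrite mxE; apply/eqP; rewrite -[_ == _]negbK y0.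
  have [j ji] : exists j : 'I_n, j != i.
    by have [j] := exists_neq2 n_ge3 i i; exists j.
  (* As y_i is nonzero and e_j has i-th component 0, the coefficient l would be 0, contradicting the
     j-th component. *)
  exists (delta_mx 0 j) => l; apply/eqP => /rowP e.
  have := e i; rewrite !mxE (eq_sym i) (negbTE ji) => /esym/eqP.
  rewrite mulf_eq0 (negbTE yi) orbF => /eqP l0.
  by have := e j; rewrite !mxE !eqxx l0 mul0r => /eqP; rewrite oner_eq0.
have wv (l : R) : w != l *: v by rewrite vk scalerA.
by rewrite -(kappa_noncollinear cx y0 wy) -(kappa_noncollinear cx v0 wv).
Qed.

Lemma kappa_locally_constant c x : chart_im c x ->
  \forall w \near x, chart_im c w /\
    forall y v, y != 0 -> v != 0 -> kappa c (w, v) = kappa c (x, y).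
Proof.
move=> cx; have /nbhs_ballP [e /= e0 be] := near_open (@chart_im_open _ _ M c) cx.
apply/nbhs_ballP; exists e => //= w bw; split=> [|y v y0 v0]; first exact: be.
rewrite -(kappa_fiber cx y0 v0).
have -> : (w, v) = (x, v) + (w - x, 0) :> V * V.
  by apply: injective_projections; rewrite /= ?addr0 // addrC subrK.
apply: kappa_segment => r /andP[r0 r1]; split; last by rewrite /= scaler0 addr0.
apply: be; move: bw; rewrite -!ball_normE /ball_ /= opprD addNKr normrN normrZ distrC.
by move=> wx; rewrite (le_lt_trans _ wx) // ger0_norm // ler_piMl.
Qed.

Lemma kappa_chart a b p y : chart_dom a p -> chart_dom b p -> y != 0 ->
  exists2 v, v != 0 & kappa b (chart b p, v) = kappa a (chart a p, y).
Proof.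
move=> ap bp y0; pose z : V * V := (chart a p, y).
have Uz : T0_overlap a b z.
  by split=> //; split; [exact: chart_sub|rewrite /= chartK].
exists (T_trans a b z).2; first by have [] := T_trans_T0 Uz.
have <- := kappa_trans F_finsler S_spray n_ge3 W0 Uz.
have -> : chart b p = (T_trans a b z).1 by rewrite /T_trans /trans /= chartK.
by rewrite -surjective_pairing.
Qed.

Lemma kappa_constant (M_connected : connected [set: M]) :
  exists k, forall a z, T0_dom a z -> kappa a z = k.
Proof.
(* The empty manifold counts as connected; any constant serves there. *)
have [[p0 _]|M0] := pselect (exists p : M, True); last first.
  by exists 0 => a z [az _]; case: M0; exists (chart_inv a z.1).
have [y0 y00] : exists y0 : V, y0 != 0.
  have n0 : (0 < n)%N by rewrite (leq_trans _ n_ge3).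
  exists (delta_mx 0 (Ordinal n0)); apply/eqP => /matrixP /(_ 0 (Ordinal n0)).
  by rewrite !mxE !eqxx => /eqP; rewrite oner_eq0.
have [a0 ap0] := chart_cover p0.
pose k := kappa a0 (chart a0 p0, y0); exists k.
pose B := [set p : M | forall a, chart_dom a p -> forall y, y != 0 ->
  kappa a (chart a p, y) = k].
(* One chart and one nonzero vector decide membership, by [kappa_chart] and [kappa_fiber]. *)
have Bchart p a y : chart_dom a p -> y != 0 -> B p <-> kappa a (chart a p, y) = k.
  move=> ap y1; split=> [/(_ a ap y y1)//|ky b bp v v1].
  have [w w0 kw] := kappa_chart ap bp y1.
  by rewrite (kappa_fiber _ w0 v1) ?kw //; exact: chart_sub.
(* Membership is locally constant, so both [B] and its complement are open. *)
have Bnear p : \forall q \near p, B q <-> B p.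
  have [a ap] := chart_cover p.
  have da : \forall q \near p, chart_dom a q.
    by apply: open_nbhs_nbhs; split; [exact: chart_dom_open|].
  have := chart_continuous ap (kappa_locally_constant (chart_sub ap)).
  move=> /(filterI da); apply: filterS => q [aq [_ kq]].
  by rewrite (Bchart _ a y0) // (Bchart p a y0) // (kq y0).
suff BT : B = [set: M].
  move=> a [x y] [/= ax y1]; have : B (chart_inv a x) by rewrite BT.
  by move=> /(_ a (chart_inv_sub ax) y y1); rewrite chart_invK.
apply: M_connected.
- by exists p0; apply/(Bchart p0 a0 y0).
- exists B; last by rewrite setTI.
  by rewrite openE => p Bp; have := Bnear p; apply: filterS => q /iffRL; apply.
- exists B; last by rewrite setTI.
  rewrite -openC openE => p nBp; have := Bnear p; apply: filterS => q /iffLR qp Bq.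
  exact/nBp/qp.
Qed.

End Constancy.
End Charts.

Theorem theorem3p1 (R : realType) (n : nat) (n_ge3 : (3 <= n)%N)
    (M : smoothManifold R n) (M_connected : connected [set: M])
    (F : tangentBundle M -> R) (F_finsler : isFinsler F)
    (S : vectorFieldT0 M) (S_spray : isGeodesicSpray F S) :
  constant_flag_curvature F S <-> W1_eq0 S.
Proof.
have n1 : (n%:R - 1 : R) != 0.
  by rewrite subr_eq0 (eqr_nat R n 1); case: n n_ge3 {M M_connected F F_finsler S S_spray}
    => [|[]].
split=> [[k Jk] a|W0].
  pose oU := @T0_dom_open _ _ M a; pose sU := @subset_refl _ (@T0_dom R n M a).
  apply/(W1_isotropic S_spray oU sU n_ge3).
  have Qk i : dy i (smooth_cst oU k) = 0 by exact: Dv_smooth_cst.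
  apply: (cfc_curv (derivation_dx oU) (derivation_dy oU) (@dydx _ _ _ oU)
    (@dydy _ _ _ oU) (dx_fibre_coord oU) (dy_fibre_coord oU) (liouville_energy F_finsler oU sU)
    (spray_dy_energy F_finsler S_spray oU sU) (@smoothFct_natreg _ _ _ oU)
    (@energy_nondeg _ _ _ _ F_finsler _ _ oU sU) Qk).
  (* Twice the curvature condition is the hypothesis of [cfc_curv] with c = kappa, since E_j = 2 F
     dF/dy^j. *)
  move=> i j; apply: ev_inj => z; rewrite inE => Uz.
  rewrite evM // (ev_jacobi S_spray) // (Jk a z Uz) ev_nat // dy_energy evM //.
  rewrite ev_smooth_cst // evB // !evM // !ev_nat // ev_fibre_coord //.
  rewrite ev_dy_finsler_fct // ev_finsler_fct //.
  ring.
have [k kE] := kappa_constant F_finsler S_spray n_ge3 W0 M_connected.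
exists k => a z Uz i j.
pose oU := @T0_dom_open _ _ M a; pose sU := @subset_refl _ (@T0_dom R n M a).
have /(congr1 (fun f => ev f z)) := energy_jacobi F_finsler S_spray oU sU
  n_ge3 (W0 a) i j.
have F0 := finsler_gt0 F_finsler Uz.
have tE : \tr (Jacobi S a z) = k * ((n%:R - 1) * Defs.repr F a z ^+ 2).
  rewrite -(kE a z Uz) /kappa divfK // mulf_neq0 // expf_neq0 //.
  exact: lt0r_neq0.
rewrite dy_energy evM // (ev_jacobi S_spray) // [RHS]evM //.
rewrite (ev_trjacobi S_spray) // tE evB //.
rewrite !evM // evB // !ev_nat // ev1 // ev_fibre_coord //.
rewrite ev_dy_finsler_fct // ev_finsler_fct //.
move: (Jacobi S a z i j) (dJ _ j z) (Defs.repr F a z) F0 => J D f f0 e.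
(* With t = (n - 1) kappa F^2, this is the common factor to cancel in [energy_jacobi] at z. *)
have c0 : 2 * (n%:R - 1) * f ^+ 2 != 0.
  by have f1 := lt0r_neq0 f0; rewrite !mulf_neq0 ?pnatr_eq0.
apply: (mulfI c0); transitivity (2 * (n%:R - 1) * (f * f) * J); first by ring.
by rewrite e; ring.
Qed.
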